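(* The following identities of formal power series hold: $$\sum_{n=0}^\infty c(\lambda^{(6)};2n)q^n=\frac{J_2^3J_3^2}{J_1^3J_6},$$ $$\sum_{n=1}^\infty\left(2c(\psi^{(6)};n)-c(\lambda^{(6)};2n-1)\right)q^n=3q\frac{J_6^3}{J_1J_2}.$$ Furthermore, for all $n\ge1$, $$c(\lambda^{(6)};2n-1)\equiv c(\psi^{(6)};n)\pmod2 .$$ For $n\ge0$, the coefficient $c(\lambda^{(6)};2n)$ is odd if and only if $n=k(k+1)/2$ for some integer $k$.
   Context: $(a;q)_n=\prod_{k=0}^{n-1}(1-aq^k)$, $(a;q)_\infty=\prod_{k\ge0}(1-aq^k)$, and $J_m=(q^m;q^m)_\infty$ for positive integers $m$. For a formal power series $g(q)=\sum_{n\ge0}c(n)q^n$, $c(g;n):=c(n)$. The sixth order mock theta functions are $$\psi^{(6)}(q)=\sum_{n=0}^\infty\frac{(-1)^nq^{(n+1)^2}(q;q^2)_n}{(-q;q)_{2n+1}},\qquad \lambda^{(6)}(q)=\sum_{n=0}^\infty\frac{(-1)^nq^n(q;q^2)_n}{(-q;q)_n}.$$ *)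

(* Defs.v *)
From HB Require Import structures.
From mathcomp Require Import all_boot all_order all_algebra.
From mathcomp Require Import boolp classical_sets.

Set Implicit Arguments.
Unset Strict Implicit.
Unset Printing Implicit Defensive.

Import Order.TTheory GRing.Theory Num.Theory.
Local Open Scope ring_scope.

Record fps (R : Type) := Fps { fcoef : nat -> R }.

Notation "{ 'fps' R }" := (fps R) (at level 0, R at level 2, format "{ 'fps'  R }").

HB.instance Definition _ (R : Type) := gen_eqMixin {fps R}.
HB.instance Definition _ (R : Type) := gen_choiceMixin {fps R}.

Lemma fpsP (R : Type) (f g : {fps R}) : fcoef f =1 fcoef g <-> f = g.
Proof. by split=> [|->//]; case: f g => [a] [b] /= /funext ->. Qed.

Section FpsZmodule.
Variable R : zmodType.
Implicit Types f g : {fps R}.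

Definition fps_zero : {fps R} := Fps (fun=> 0).
Definition fps_opp f := Fps (fun n => - fcoef f n).
Definition fps_add f g := Fps (fun n => fcoef f n + fcoef g n).

Fact fps_addA : associative fps_add.
Proof. by move=> f g h; apply/fpsP => n /=; rewrite addrA. Qed.
Fact fps_addC : commutative fps_add.
Proof. by move=> f g; apply/fpsP => n /=; rewrite addrC. Qed.
Fact fps_add0 : left_id fps_zero fps_add.
Proof. by move=> f; apply/fpsP => n /=; rewrite add0r. Qed.
Fact fps_addN : left_inverse fps_zero fps_opp fps_add.
Proof. by move=> f; apply/fpsP => n /=; rewrite addNr. Qed.

HB.instance Definition _ :=
  GRing.isZmodule.Build {fps R} fps_addA fps_addC fps_add0 fps_addN.

Lemma fcoef0 n : fcoef (0 : {fps R}) n = 0. Proof. by []. Qed.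
Lemma fcoefD f g n : fcoef (f + g) n = fcoef f n + fcoef g n. Proof. by []. Qed.
Lemma fcoefN f n : fcoef (- f) n = - fcoef f n. Proof. by []. Qed.
Lemma fcoefB f g n : fcoef (f - g) n = fcoef f n - fcoef g n. Proof. by []. Qed.
Lemma fcoef_sum I (r : seq I) (P : pred I) (F : I -> {fps R}) n :
  fcoef (\sum_(i <- r | P i) F i) n = \sum_(i <- r | P i) fcoef (F i) n.
Proof. by elim/big_rec2: _ => [//|i x y _ <-]; rewrite fcoefD. Qed.

End FpsZmodule.

Section FpsRing.
Variable R : comUnitRingType.
Implicit Types f g h : {fps R}.

Definition fps_one : {fps R} := Fps (fun n => (n == 0)%:R).
Definition fps_mul f g :=
  Fps (fun n => \sum_(i < n.+1) fcoef f i * fcoef g (n - i)).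

Definition fps_trunc N f : {poly R} := \poly_(i < N) fcoef f i.

Lemma coef_fps_trunc N f i : (i < N)%N -> (fps_trunc N f)`_i = fcoef f i.
Proof. by move=> iN; rewrite coef_poly iN. Qed.

Lemma fcoef_fps_mul N f g n : (n < N)%N ->
  fcoef (fps_mul f g) n = (fps_trunc N f * fps_trunc N g)`_n.
Proof.
move=> nN; rewrite coefM /=; apply: eq_bigr => i _.
rewrite !coef_fps_trunc //; first exact: leq_ltn_trans (leq_subr _ _) nN.
by apply: leq_trans nN; rewrite ltn_ord.
Qed.

Fact fps_mulA : associative fps_mul.
Proof.
move=> f g h; apply/fpsP => n.
transitivity ((fps_trunc n.+1 f * (fps_trunc n.+1 g * fps_trunc n.+1 h))`_n).
  rewrite coefM [LHS]/=; apply: eq_bigr => i _.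
  by rewrite coef_fps_trunc // -fcoef_fps_mul // ltnS leq_subr.
rewrite mulrA coefM [RHS]/=; apply: eq_bigr => i _.
by rewrite -fcoef_fps_mul // coef_fps_trunc // ltnS leq_subr.
Qed.

Fact fps_mulC : commutative fps_mul.
Proof.
by move=> f g; apply/fpsP => n; rewrite !(@fcoef_fps_mul n.+1) // mulrC.
Qed.

Fact fps_mul1 : left_id fps_one fps_mul.
Proof.
move=> f; apply/fpsP => n /=.
by rewrite big_ord_recl /= mul1r subn0 big1 ?addr0 // => i _; rewrite mul0r.
Qed.

Fact fps_mulDl : left_distributive fps_mul (@fps_add R).
Proof.
move=> f g h; apply/fpsP => n /=.
by rewrite -big_split; apply: eq_bigr => i _; rewrite mulrDl.
Qed.

Fact fps_one_neq0 : fps_one != 0.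
Proof.
by apply/eqP => /fpsP/(_ 0%N)/eqP; rewrite fcoef0 /= oner_eq0.
Qed.

HB.instance Definition _ := GRing.Zmodule_isComNzRing.Build {fps R}
  fps_mulA fps_mulC fps_mul1 fps_mulDl fps_one_neq0.

Lemma fcoef1 n : fcoef (1 : {fps R}) n = (n == 0)%:R. Proof. by []. Qed.
Lemma fcoefM f g n :
  fcoef (f * g) n = \sum_(i < n.+1) fcoef f i * fcoef g (n - i).
Proof. by []. Qed.
Lemma fcoefM0 f g : fcoef (f * g) 0 = fcoef f 0 * fcoef g 0.
Proof. by rewrite fcoefM big_ord_recl big_ord0 addr0 subn0. Qed.

(* A series is invertible iff its constant coefficient is; the coefficients
   b_n of the inverse of sum_n a_n q^n are then determined by
   a_0 b_{n+1} = - sum_{i <= n} a_{n+1-i} b_i. The list below is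
   [:: b_0; ...; b_n]. *)
Fixpoint fps_inv_seq f n : seq R :=
  if n is n'.+1 then
    let s := fps_inv_seq f n' in
    rcons s (- (fcoef f 0)^-1 * \sum_(i < n) fcoef f (n - i) * s`_i)
  else [:: (fcoef f 0)^-1].

Definition fps_unit : pred {fps R} := [pred f | fcoef f 0 \is a GRing.unit].
Definition fps_inv f :=
  if fps_unit f then Fps (fun n => (fps_inv_seq f n)`_n) else f.

Lemma size_fps_inv_seq f n : size (fps_inv_seq f n) = n.+1.
Proof. by elim: n => //= n IHn; rewrite size_rcons IHn. Qed.

Lemma nth_fps_inv_seq f n i : (i <= n)%N ->
  (fps_inv_seq f n)`_i = (fps_inv_seq f i)`_i.
Proof.
elim: n => [|n IHn]; first by rewrite leqn0 => /eqP ->.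
rewrite leq_eqVlt ltnS => /orP[/eqP -> //|lin].
by rewrite [in LHS]/= nth_rcons size_fps_inv_seq ltnS lin IHn.
Qed.

Fact fps_mulVf : {in fps_unit, left_inverse 1 fps_inv *%R}.
Proof.
move=> f uf; rewrite mulrC /fps_inv; have u0 := uf; rewrite unfold_in /= in u0.
rewrite [fps_unit f]uf; apply/fpsP => -[|n].
  by rewrite fcoefM0 fcoef1 /= mulrV.
rewrite fcoefM fcoef1 big_ord_recl subn0.
have -> : fcoef (Fps (fun k => (fps_inv_seq f k)`_k)) n.+1 =
    - (fcoef f 0)^-1 * \sum_(i < n.+1) fcoef f (n.+1 - i) * (fps_inv_seq f n)`_i.
  by rewrite /= nth_rcons size_fps_inv_seq ltnn eqxx.
rewrite mulrA mulrN mulrV // mulN1r addrC; apply/eqP; rewrite subr_eq0; apply/eqP.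
rewrite (reindex_inj rev_ord_inj); apply: eq_bigr => i _.
have lin : (i <= n)%N by rewrite -ltnS.
have -> : lift ord0 (rev_ord i) = (n.+1 - i)%N :> nat.
  by rewrite /= /bump /= add1n subSS subSn.
by rewrite subKn ?[in RHS]nth_fps_inv_seq // leqW.
Qed.

Fact fps_unitPl f g : g * f = 1 -> fps_unit f.
Proof.
move=> /fpsP/(_ 0%N); rewrite fcoefM0 fcoef1 /= => gf1.
rewrite -[fps_unit f]/(fcoef f 0 \is a GRing.unit); apply/unitrP; exists (fcoef g 0).
by split=> //; rewrite mulrC.
Qed.

Fact fps_inv_out : {in [predC fps_unit], fps_inv =1 id}.
Proof. by move=> f /negPf nuf; rewrite /fps_inv [fps_unit f]nuf. Qed.

HB.instance Definition _ := GRing.ComNzRing_hasMulInverse.Build {fps R}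
  fps_mulVf fps_unitPl fps_inv_out.

Lemma fps_unitE f : (f \is a GRing.unit) = (fcoef f 0 \is a GRing.unit).
Proof. by []. Qed.

Definition fpsX : {fps R} := Fps (fun n => (n == 1)%:R).

Lemma fcoefXnM k f n :
  fcoef (fpsX ^+ k * f) n = if (n < k)%N then 0 else fcoef f (n - k).
Proof.
elim: k n => [|k IHk] n; first by rewrite mul1r subn0.
rewrite exprS -mulrA fcoefM; case: n => [|n].
  by rewrite big_ord_recl big_ord0 mul0r addr0.
rewrite big_ord_recl mul0r add0r big_ord_recl.
have -> : (n.+1 - lift ord0 (@ord0 n) = n)%N by rewrite lift0 subn1.
rewrite IHk ltnS subSS mul1r.
by rewrite big1 ?addr0 // => i _; rewrite mul0r.
Qed.

(* Convergence in the q-adic topology: every coefficient is eventually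
   constant. *)
Definition fps_cvg (u : nat -> {fps R}) (f : {fps R}) :=
  forall m, exists N, forall n, (N <= n)%N -> fcoef (u n) m = fcoef f m.

(* The junk value is 0 when u does not converge. *)
Definition fps_lim (u : nat -> {fps R}) : {fps R} := xget 0 [set f | fps_cvg u f].

Lemma fps_cvg_unique u f g : fps_cvg u f -> fps_cvg u g -> f = g.
Proof.
move=> uf ug; apply/fpsP => m; have [N HN] := uf m; have [M HM] := ug m.
by rewrite -(HN (maxn N M)) ?leq_maxl // (HM (maxn N M)) ?leq_maxr.
Qed.

Lemma fps_cvg_lim u f : fps_cvg u f -> fps_lim u = f.
Proof. by move=> uf; apply: xget_unique => // g /fps_cvg_unique; apply. Qed.

Lemma fps_is_cvg u :
  (forall m, exists N, forall n, (N <= n)%N -> fcoef (u n.+1) m = fcoef (u n) m) ->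
  fps_cvg u (fps_lim u).
Proof.
move=> /choice[N HN]; rewrite (@fps_cvg_lim _ (Fps (fun m => fcoef (u (N m)) m))).
  move=> m; exists (N m) => n; elim: n => [|n IHn].
    by rewrite leqn0 => /eqP <-.
  by rewrite leq_eqVlt => /predU1P[<- //|lt]; rewrite HN // IHn.
move=> m; exists (N m) => n; elim: n => [|n IHn].
  by rewrite leqn0 => /eqP <-.
by rewrite leq_eqVlt => /predU1P[<- //|lt]; rewrite HN // IHn.
Qed.

Definition fps_sum (a : nat) (F : nat -> {fps R}) : {fps R} :=
  fps_lim (fun N => \sum_(a <= n < N) F n).

Definition fps_prod (a : nat) (F : nat -> {fps R}) : {fps R} :=
  fps_lim (fun N => \prod_(a <= n < N) F n).

Lemma fps_sum_cvg a F :
  (forall n m, (m < n)%N -> fcoef (F n) m = 0) ->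
  fps_cvg (fun N => \sum_(a <= n < N) F n) (fps_sum a F).
Proof.
move=> HF; apply: fps_is_cvg => m; exists (maxn a m.+1) => n.
rewrite geq_max => /andP[an mn].
by rewrite big_nat_recr // fcoefD HF ?addr0.
Qed.

Lemma fps_prod_cvg a F :
  (forall n m, (m < n)%N -> fcoef (F n) m = fcoef (1 : {fps R}) m) ->
  fps_cvg (fun N => \prod_(a <= n < N) F n) (fps_prod a F).
Proof.
move=> HF; apply: fps_is_cvg => m; exists (maxn a m.+1) => n.
rewrite geq_max => /andP[an mn].
rewrite big_nat_recr //= -[X in _ = fcoef X _]mulr1 !fcoefM.
by apply: eq_bigr => i _; rewrite HF // (leq_ltn_trans (leq_subr _ _)).
Qed.

Definition qpoch (a q : {fps R}) (n : nat) : {fps R} :=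
  \prod_(0 <= k < n) (1 - a * q ^+ k).

Definition qpoch_inf (a q : {fps R}) : {fps R} :=
  fps_prod 0 (fun k => 1 - a * q ^+ k).

End FpsRing.

Notation "''q'" := (@fpsX ssrint.ssrint_int__canonical__GRing_ComUnitRing)
  (at level 0) : ring_scope.

Definition J (m : nat) : {fps int} := qpoch_inf ('q ^+ m) ('q ^+ m).

Definition psi6 : {fps int} :=
  fps_sum 0 (fun n => (-1) ^+ n * 'q ^+ ((n + 1) ^ 2) * qpoch 'q ('q ^+ 2) n
                      / qpoch (- 'q) 'q (2 * n + 1)).

Definition lambda6 : {fps int} :=
  fps_sum 0 (fun n => (-1) ^+ n * 'q ^+ n * qpoch 'q ('q ^+ 2) n
                      / qpoch (- 'q) 'q n).

Lemma qpoch_coef0 (R : comUnitRingType) (a q : {fps R}) n :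
  fcoef a 0 = 0 -> fcoef (qpoch a q n) 0 = 1.
Proof.
move=> a0; rewrite /qpoch; elim: n => [|n IHn]; first by rewrite big_nil.
by rewrite big_nat_recr // fcoefM0 IHn fcoefB fcoefM0 a0 mul0r subr0 mul1r.
Qed.

Lemma fcoef_sum_Xn (R : comUnitRingType) (a : nat) (c : nat -> int) m :
  fcoef (fps_sum a (fun n => (c n)%:~R * fpsX R ^+ n)) m =
  if (a <= m)%N then (c m)%:~R else 0.
Proof.
pose F n : {fps R} := (c n)%:~R * fpsX R ^+ n.
have fcoefz z k : fcoef (z%:~R : {fps R}) k = if k == 0%N then z%:~R else 0.
  have fnat i : fcoef (i%:R : {fps R}) k = if k == 0%N then i%:R else 0.
    elim: i => [|i IHi]; first by rewrite fcoef0 if_same.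
    by rewrite -natr1 fcoefD IHi fcoef1 -natr1; case: eqP; rewrite ?addr0.
  by case: z => i; rewrite ?NegzE ?mulrNz ?fcoefN fnat; case: eqP; rewrite ?oppr0.
have FE n k : fcoef (F n) k = if k == n then (c n)%:~R else 0.
  rewrite /F mulrC fcoefXnM fcoefz subn_eq0.
  by case: ltngtP.
have HF n k : (k < n)%N -> fcoef (F n) k = 0 by rewrite FE; case: ltngtP.
have [N /(_ (maxn N m.+1) (leq_maxl _ _)) <-] := fps_sum_cvg a HF m.
rewrite fcoef_sum; case: leqP => am.
  rewrite (big_cat_nat _ (n := m)) //; last by rewrite ltnW // leq_maxr.
  rewrite big_nat_cond big1; last first.
    by move=> i /andP[/andP[_ im] _]; rewrite FE gtn_eqF.
  rewrite big_ltn ?leq_maxr // FE eqxx big_nat_cond big1; first by rewrite /= add0r addr0.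
  by move=> i /andP[/andP[mi _] _]; rewrite FE ltn_eqF.
rewrite big_nat_cond big1 // => i /andP[/andP[ai _] _].
by rewrite FE ltn_eqF // (leq_trans am).
Qed.

Lemma J_cvg m : (0 < m)%N ->
  fps_cvg (fun N => qpoch ('q ^+ m) ('q ^+ m) N) (J m).
Proof.
move=> m0; apply: fps_prod_cvg => n k kn.
rewrite fcoefB -exprM -exprD -[X in _ - fcoef X _]mulr1 fcoefXnM.
by rewrite (leq_trans kn) ?subr0 // (leq_trans (leq_pmull _ m0)) // leq_addl.
Qed.

Lemma psi6_cvg : fps_cvg (fun N => \sum_(0 <= n < N)
  ((-1) ^+ n * 'q ^+ ((n + 1) ^ 2) * qpoch 'q ('q ^+ 2) n
     / qpoch (- 'q) 'q (2 * n + 1))) psi6.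
Proof.
apply: fps_sum_cvg => n m mn.
rewrite [(-1) ^+ n * _]mulrC -!mulrA fcoefXnM (leq_trans mn) //.
by rewrite (leq_trans (leq_addr 1 n)) // -[leqLHS]muln1 leq_mul // leq_addl.
Qed.

Lemma lambda6_cvg : fps_cvg (fun N => \sum_(0 <= n < N)
  ((-1) ^+ n * 'q ^+ n * qpoch 'q ('q ^+ 2) n / qpoch (- 'q) 'q n)) lambda6.
Proof.
by apply: fps_sum_cvg => n m mn; rewrite [(-1) ^+ n * _]mulrC -!mulrA fcoefXnM mn.
Qed.

Lemma qpoch_q_unit n : qpoch (- 'q) 'q n \is a GRing.unit.
Proof. by rewrite fps_unitE qpoch_coef0. Qed.

Lemma J_unit m : (0 < m)%N -> J m \is a GRing.unit.
Proof.
move=> m0; rewrite fps_unitE; have [N /(_ N (leqnn N)) <-] := J_cvg m0 0.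
by rewrite qpoch_coef0 // -['q ^+ m]mulr1 fcoefXnM m0.
Qed.

(* Main.v *)
Require Import Defs.
From HB Require Import structures.
From mathcomp Require Import all_boot all_order all_algebra.
From mathcomp Require Import boolp classical_sets cardinality fsbigop.
From mathcomp Require Import zify ring.

(** Put B_k = q^k (q^(k+1);q)_oo (-q^(k+2);q^2)_oo / (-q^(k+1);q^2)_oo, the
    series [bterm].  Expanding 1/(e q^(n+1);q)_oo by Euler's theorem and then
    summing over n by the q-binomial theorem with base q^2 shows ([bterm_sum])
    that sum_k e^k B_k is, for e = 1, the function lambda and, for e = -1, the
    product (q;q)_oo/(-q;q)_oo times sum_n (-q)^n (q;q^2)_n/(q;q)_n.  Write A
    and O for the sums of B_k over even and over odd k, so that
    lambda = A + O.

    - The odd terms give the other mock theta function: q O = psi(q^2).  Each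
      odd term is q^(-1) times a series in q^2, and after replacing q^2 by q
      their sum becomes psi by one application of Euler's theorem and one of
      the q-binomial theorem ([psi6_product_sum], [bterm_odd]).
    - The alternating sum A - O is modular.  The Bailey pair with
      beta_n = 1/(q;q)_n and a q-Gauss sum turn it into
      J_1^3/J_2^3 * sum_(r >= 0) q^(3r(r+1)/2) ([alternating_theta]).
      Jacobi's series for J_1^3 makes the product of J_1^3 and this theta
      series a sum over the lattice Z^2 of a weight times q to the power
      (a^2 + 3b^2 - 4)/8 with a, b odd.  The change of variables a = u + 3v,
      b = u - v separates the even from the odd powers of q, and
      [cube_dissection] reads
      A - O = E(q^2) - 3 q D(q^2), with E = J_2^3 J_3^2/(J_1^3 J_6) and
      D = J_6^3/(J_1 J_2).

    Hence q lambda = 2 psi(q^2) + q E(q^2) - 3 q^2 D(q^2), which is the pair of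
    identities.  Modulo 2 a product does not change when the sign of its
    argument does, so that B_(2m) is congruent to q^(2m) (q^(4m+4);q^4)_oo,
    which has only even powers of q ([even_bterm_odd_coef]); therefore lambda
    and O have congruent odd coefficients, and those of O are the coefficients
    of psi.  Finally J_m^2 is congruent to J_(2m), so E is congruent to J_1^3,
    whose series has odd coefficients exactly at the triangular numbers. *)

Set Implicit Arguments.
Unset Strict Implicit.
Unset Printing Implicit Defensive.

Import Order.TTheory GRing.Theory Num.Theory.
Local Open Scope ring_scope.

(** * Congruence modulo a power of the variable *)

Definition eqm (R : comUnitRingType) (N : nat) (f g : {fps R}) :=
  forall m, (m < N)%N -> fcoef f m = fcoef g m.

Lemma eqm_refl (R : comUnitRingType) N (f : {fps R}) : eqm N f f.
Proof. by []. Qed.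

Lemma eqm_sym (R : comUnitRingType) N (f g : {fps R}) : eqm N f g -> eqm N g f.
Proof. by move=> fg m mN; rewrite fg. Qed.

Lemma eqm_trans (R : comUnitRingType) N (g f h : {fps R}) :
  eqm N f g -> eqm N g h -> eqm N f h.
Proof. by move=> fg gh m mN; rewrite fg ?gh. Qed.

Lemma eqm_leq (R : comUnitRingType) M N (f g : {fps R}) :
  (M <= N)%N -> eqm N f g -> eqm M f g.
Proof. by move=> MN fg m mM; apply: fg; apply: leq_trans MN. Qed.

Lemma eqmP (R : comUnitRingType) (f g : {fps R}) :
  (forall N, eqm N f g) -> f = g.
Proof. by move=> fg; apply/fpsP => m; apply: (fg m.+1). Qed.

Lemma eqmD (R : comUnitRingType) N (f f' g g' : {fps R}) :
  eqm N f f' -> eqm N g g' -> eqm N (f + g) (f' + g').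
Proof. by move=> ff gg m mN; rewrite !fcoefD ff ?gg. Qed.

Lemma eqmB (R : comUnitRingType) N (f f' g g' : {fps R}) :
  eqm N f f' -> eqm N g g' -> eqm N (f - g) (f' - g').
Proof. by move=> ff gg m mN; rewrite !fcoefB ff ?gg. Qed.

Lemma eqmM (R : comUnitRingType) N (f f' g g' : {fps R}) :
  eqm N f f' -> eqm N g g' -> eqm N (f * g) (f' * g').
Proof.
move=> ff gg m mN; rewrite !fcoefM; apply: eq_bigr => i _.
rewrite ff ?gg //; first exact: leq_ltn_trans (leq_subr _ _) mN.
by apply: leq_trans mN; rewrite ltn_ord.
Qed.

Lemma eqm_sum (R : comUnitRingType) N (I : Type) (r : seq I) (P : pred I)
    (F G : I -> {fps R}) :
  (forall i, P i -> eqm N (F i) (G i)) ->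
  eqm N (\sum_(i <- r | P i) F i) (\sum_(i <- r | P i) G i).
Proof.
by move=> FG m mN; rewrite !fcoef_sum; apply: eq_bigr => i /FG; apply.
Qed.

Lemma eqm0M (R : comUnitRingType) a b (f g : {fps R}) :
  eqm a f 0 -> eqm b g 0 -> eqm (a + b) (f * g) 0.
Proof.
move=> f0 g0 m mab; rewrite fcoefM big1 // => i _.
have [ia|ai] := ltnP i a; first by rewrite f0 // mul0r.
by rewrite g0 ?mulr0 //; have := ltn_ord i; lia.
Qed.

Lemma eqm0Ml (R : comUnitRingType) a (f g : {fps R}) :
  eqm a f 0 -> eqm a (f * g) 0.
Proof. by move=> f0; rewrite -[a]addn0; apply: eqm0M. Qed.

Lemma eqm0Mr (R : comUnitRingType) a (f g : {fps R}) :
  eqm a g 0 -> eqm a (f * g) 0.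
Proof. by rewrite mulrC; apply: eqm0Ml. Qed.

Lemma eqm0X (R : comUnitRingType) (f : {fps R}) n :
  fcoef f 0 = 0 -> eqm n (f ^+ n) 0.
Proof.
move=> f0; elim: n => [//|n IHn]; rewrite exprSr -addn1.
by apply: eqm0M => // -[].
Qed.

(** * Infinite sums *)

(** The order of the n-th term is at least n: this is convergence of the sum
    together with the explicit rate used to truncate it. *)
Definition summable (R : comUnitRingType) (F : nat -> {fps R}) :=
  forall n, eqm n (F n) 0.

Lemma fps_sum_eqm (R : comUnitRingType) (F : nat -> {fps R}) N M :
  summable F -> (N <= M)%N -> eqm N (fps_sum 0 F) (\sum_(0 <= n < M) F n).
Proof.
move=> sF NM m mN.
have [K /(_ (K + M)%N (leq_addr _ _)) <-] :=
  fps_sum_cvg 0 (fun n m => sF n m) m.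
rewrite (big_cat_nat _ (n := M)) ?leq_addl //= [X in _ + X]fcoef_sum.
rewrite [X in _ + X]big1_seq ?addr0 // => i /andP[_].
rewrite mem_index_iota => /andP[Mi _]; apply: sF.
by apply: leq_trans Mi; apply: leq_trans NM.
Qed.

Lemma fps_sumP (R : comUnitRingType) (F : nat -> {fps R}) f :
  summable F -> (forall N, eqm N (\sum_(0 <= n < N) F n) f) ->
  fps_sum 0 F = f.
Proof.
move=> sF Ff; apply: eqmP => N.
by apply: eqm_trans (Ff N); apply: fps_sum_eqm.
Qed.

Lemma eq_fps_sum (R : comUnitRingType) (F G : nat -> {fps R}) :
  F =1 G -> fps_sum 0 F = fps_sum 0 G.
Proof. by move=> /boolp.funext ->. Qed.

Lemma fps_sum_eqm0 (R : comUnitRingType) (F : nat -> {fps R}) N :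
  summable F -> (forall n, eqm N (F n) 0) -> eqm N (fps_sum 0 F) 0.
Proof.
move=> sF F0; apply: eqm_trans (fps_sum_eqm sF (leqnn N)) _ => m mN.
by rewrite fcoef_sum big1 // => i _; apply: F0.
Qed.

Lemma summableMl (R : comUnitRingType) (F : nat -> {fps R}) c :
  summable F -> summable (fun n => c * F n).
Proof. by move=> sF n; apply: eqm0Mr. Qed.

Lemma fps_sumMl (R : comUnitRingType) (F : nat -> {fps R}) c :
  summable F -> fps_sum 0 (fun n => c * F n) = c * fps_sum 0 F.
Proof.
move=> sF; apply: fps_sumP => [|N]; first exact: summableMl.
rewrite -mulr_sumr; apply: eqmM => //; apply: eqm_sym.
exact: fps_sum_eqm.
Qed.

Lemma fps_sumD (R : comUnitRingType) (F G : nat -> {fps R}) :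
  summable F -> summable G ->
  fps_sum 0 (fun n => F n + G n) = fps_sum 0 F + fps_sum 0 G.
Proof.
move=> sF sG; apply: fps_sumP => [n|N].
  by rewrite -[X in eqm _ _ X](addr0 0); apply: eqmD.
by rewrite big_split; apply: eqmD; apply: eqm_sym; apply: fps_sum_eqm.
Qed.

Lemma fps_sumB (R : comUnitRingType) (F G : nat -> {fps R}) :
  summable F -> summable G ->
  fps_sum 0 (fun n => F n - G n) = fps_sum 0 F - fps_sum 0 G.
Proof.
move=> sF sG; apply: fps_sumP => [n|N].
  by rewrite -[X in eqm _ _ X](subr0 0); apply: eqmB.
by rewrite sumrB; apply: eqmB; apply: eqm_sym; apply: fps_sum_eqm.
Qed.

Lemma fps_sum_recl (R : comUnitRingType) (F : nat -> {fps R}) :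
  summable F -> fps_sum 0 F = F 0%N + fps_sum 0 (fun n => F n.+1).
Proof.
move=> sF; have sF1 : summable (fun n => F n.+1).
  by move=> n; apply: eqm_leq (sF n.+1).
apply: eqmP => N; apply: eqm_trans (fps_sum_eqm sF (leqnSn N)) _.
rewrite big_nat_recl //; apply: eqmD => //; apply: eqm_sym.
exact: fps_sum_eqm.
Qed.

(** Modulo the N-th power of the variable only the terms with i, j < N count,
    so both iterated sums reduce to the same finite double sum. *)
Lemma fps_sum_exchange (R : comUnitRingType) (F : nat -> nat -> {fps R}) :
  (forall i j, eqm i (F i j) 0) -> (forall i j, eqm j (F i j) 0) ->
  fps_sum 0 (fun i => fps_sum 0 (fun j => F i j)) =
  fps_sum 0 (fun j => fps_sum 0 (fun i => F i j)).
Proof.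
move=> Fi Fj.
have s1 i : summable (F i) by move=> j; apply: Fj.
have s2 j : summable (F^~ j) by move=> i; apply: Fi.
apply: eqmP => N; apply: eqm_trans (fps_sum_eqm _ (leqnn N)) _.
  by move=> i; apply: fps_sum_eqm0.
apply: (@eqm_trans _ _ (\sum_(0 <= i < N) \sum_(0 <= j < N) F i j)).
  by apply: eqm_sum => i _; apply: fps_sum_eqm.
rewrite exchange_big /=; apply: eqm_sym.
apply: eqm_trans (fps_sum_eqm _ (leqnn N)) _.
  by move=> j; apply: fps_sum_eqm0.
by apply: eqm_sum => j _; apply: fps_sum_eqm.
Qed.

Lemma fps_sum_parity (R : comUnitRingType) (F : nat -> {fps R}) :
  summable F ->
  fps_sum 0 F = fps_sum 0 (fun n => F (2 * n)%N)
              + fps_sum 0 (fun n => F (2 * n + 1)%N).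
Proof.
move=> sF.
have s0 : summable (fun n => F (2 * n)%N).
  by move=> n; apply: eqm_leq (sF _); lia.
have s1 : summable (fun n => F (2 * n + 1)%N).
  by move=> n; apply: eqm_leq (sF _); lia.
apply: eqmP => N.
apply: eqm_trans (fps_sum_eqm sF (_ : N <= 2 * N)%N) _; first lia.
have -> : \sum_(0 <= n < 2 * N) F n =
    \sum_(0 <= n < N) F (2 * n)%N + \sum_(0 <= n < N) F (2 * n + 1)%N.
  elim: N => [|n IHn]; first by rewrite !big_geq // addr0.
  rewrite mulnS addSn add1n !big_nat_recr //= IHn addn1 -!addrA.
  by congr (_ + _); rewrite addrCA.
by apply: eqmD; apply: eqm_sym; apply: fps_sum_eqm.
Qed.

(** * Infinite products *)

Lemma qpoch0 (R : comUnitRingType) (a Q : {fps R}) : qpoch a Q 0 = 1.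
Proof. by rewrite /qpoch big_geq. Qed.

Lemma qpochS (R : comUnitRingType) (a Q : {fps R}) n :
  qpoch a Q n.+1 = qpoch a Q n * (1 - a * Q ^+ n).
Proof. by rewrite /qpoch big_nat_recr. Qed.

Lemma qpochD (R : comUnitRingType) (a Q : {fps R}) n m :
  qpoch a Q (n + m) = qpoch a Q n * qpoch (a * Q ^+ n) Q m.
Proof.
elim: m => [|m IHm]; first by rewrite addn0 qpoch0 mulr1.
by rewrite addnS !qpochS IHm -mulrA -[a * _ * _]mulrA -exprD.
Qed.

Lemma qpoch_eqm1 (R : comUnitRingType) (a Q : {fps R}) N n :
  eqm N a 0 -> eqm N (qpoch a Q n) 1.
Proof.
move=> a0; elim: n => [|n IHn]; first by rewrite qpoch0.
rewrite qpochS -[X in eqm _ _ X](mulr1 1); apply: eqmM => //.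
rewrite -[X in eqm _ _ X](subr0 1); apply: eqmB => //.
exact: eqm0Ml.
Qed.

Lemma qpoch_inf_eqm (R : comUnitRingType) (a Q : {fps R}) n m :
  fcoef a 0 = 0 -> fcoef Q 0 = 0 -> (n <= m)%N ->
  eqm n (qpoch_inf a Q) (qpoch a Q m).
Proof.
move=> a0 Q0 nm k kn.
have aQ l : eqm l.+1 (a * Q ^+ l) 0.
  by rewrite -add1n; apply: eqm0M; [case | apply: eqm0X].
have [|K /(_ (m + K)%N (leq_addl _ _)) <-] :=
  @fps_prod_cvg _ 0 (fun k => 1 - a * Q ^+ k) _ k.
  by move=> l j jl; rewrite fcoefB aQ ?subr0 // ltnW.
rewrite -/(qpoch a Q (m + K)) qpochD -[in RHS](mulr1 (qpoch a Q m)).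
have : eqm k.+1 (qpoch (a * Q ^+ m) Q K) 1.
  by apply: qpoch_eqm1; apply: eqm_leq (aQ m); lia.
by move=> /(eqmM (@eqm_refl _ k.+1 (qpoch a Q m))); apply.
Qed.

Lemma qpoch_inf_eqm1 (R : comUnitRingType) (a Q : {fps R}) N :
  fcoef a 0 = 0 -> fcoef Q 0 = 0 -> eqm N a 0 -> eqm N (qpoch_inf a Q) 1.
Proof.
by move=> a0 Q0 aN; apply: eqm_trans (qpoch_inf_eqm a0 Q0 (leqnn N)) (qpoch_eqm1 _ _ aN).
Qed.

Lemma qpoch_infD (R : comUnitRingType) (a Q : {fps R}) n :
  fcoef a 0 = 0 -> fcoef Q 0 = 0 ->
  qpoch_inf a Q = qpoch a Q n * qpoch_inf (a * Q ^+ n) Q.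
Proof.
move=> a0 Q0; apply: eqmP => N.
apply: eqm_trans (qpoch_inf_eqm a0 Q0 (leq_addl n N)) _.
rewrite qpochD; apply: eqmM => //; apply: eqm_sym; apply: qpoch_inf_eqm => //.
by rewrite fcoefM0 a0 mul0r.
Qed.

Lemma qpoch_inf_coef0 (R : comUnitRingType) (a Q : {fps R}) :
  fcoef a 0 = 0 -> fcoef Q 0 = 0 -> fcoef (qpoch_inf a Q) 0 = 1.
Proof.
by move=> a0 Q0; rewrite (qpoch_inf_eqm a0 Q0 (leqnn 1)) ?qpoch_coef0.
Qed.

Lemma qpoch_inf_unit (R : comUnitRingType) (a Q : {fps R}) :
  fcoef a 0 = 0 -> fcoef Q 0 = 0 -> qpoch_inf a Q \is a GRing.unit.
Proof. by move=> a0 Q0; rewrite fps_unitE qpoch_inf_coef0 ?unitr1. Qed.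

Lemma qpoch_unit (R : comUnitRingType) (a Q : {fps R}) n :
  fcoef a 0 = 0 -> qpoch a Q n \is a GRing.unit.
Proof. by move=> a0; rewrite fps_unitE qpoch_coef0 ?unitr1. Qed.

Lemma qpoch_dissect2 (R : comUnitRingType) (a Q : {fps R}) n :
  qpoch a Q (2 * n) = qpoch a (Q ^+ 2) n * qpoch (a * Q) (Q ^+ 2) n.
Proof.
elim: n => [|n IHn]; first by rewrite !qpoch0 mulr1.
rewrite mulnS addSn add1n !qpochS IHn -exprM (exprS Q (2 * n)).
by ring.
Qed.

Lemma qpoch_inf_dissect2 (R : comUnitRingType) (a Q : {fps R}) :
  fcoef a 0 = 0 -> fcoef Q 0 = 0 ->
  qpoch_inf a Q = qpoch_inf a (Q ^+ 2) * qpoch_inf (a * Q) (Q ^+ 2).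
Proof.
move=> a0 Q0; apply: eqmP => N.
apply: eqm_trans (qpoch_inf_eqm a0 Q0 (_ : N <= 2 * N)%N) _; first lia.
have Q20 : fcoef (Q ^+ 2) 0 = 0 by rewrite fcoefM0 Q0 mul0r.
rewrite qpoch_dissect2; apply: eqmM; apply: eqm_sym; apply: qpoch_inf_eqm => //.
by rewrite fcoefM0 a0 mul0r.
Qed.

Lemma qpochNM (R : comUnitRingType) (a Q : {fps R}) n :
  qpoch a Q n * qpoch (- a) Q n = qpoch (a ^+ 2) (Q ^+ 2) n.
Proof.
elim: n => [|n IHn]; first by rewrite !qpoch0 mulr1.
by rewrite !qpochS -IHn -exprM mulnC exprM; ring.
Qed.

Lemma qpoch_infNM (R : comUnitRingType) (a Q : {fps R}) :
  fcoef a 0 = 0 -> fcoef Q 0 = 0 ->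
  qpoch_inf a Q * qpoch_inf (- a) Q = qpoch_inf (a ^+ 2) (Q ^+ 2).
Proof.
move=> a0 Q0; apply: eqmP => N; apply: eqm_sym.
have [Q20 a20] : fcoef (Q ^+ 2) 0 = 0 /\ fcoef (a ^+ 2) 0 = 0.
  by rewrite !fcoefM0 Q0 a0 !mul0r.
apply: eqm_trans (qpoch_inf_eqm a20 Q20 (leqnn N)) _.
rewrite -qpochNM; apply: eqmM; apply: eqm_sym; apply: qpoch_inf_eqm => //.
by rewrite fcoefN a0 oppr0.
Qed.

(** * The q-binomial theorem *)

(** The terms of the q-binomial series, homogeneous in a and b: b = 0 gives
    Euler's expansion of an infinite product, a = 0 that of its inverse. *)
Definition cauchy_coef (R : comUnitRingType) (a b Q : {fps R}) n :=
  (\prod_(0 <= k < n) (b - a * Q ^+ k)) / qpoch Q Q n.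

Lemma cauchy_coefS (R : comUnitRingType) (a b Q : {fps R}) n :
  fcoef Q 0 = 0 ->
  cauchy_coef a b Q n.+1 * (1 - Q ^+ n.+1) = cauchy_coef a b Q n * (b - a * Q ^+ n).
Proof.
move=> Q0; rewrite /cauchy_coef big_nat_recr //= qpochS -exprS.
have u : 1 - Q ^+ n.+1 \is a GRing.unit.
  by rewrite fps_unitE fcoefB exprS fcoefM0 Q0 mul0r subr0 unitr1.
rewrite invrM ?qpoch_unit // -!mulrA; congr (_ * _).
by rewrite [X in _^-1 * X]mulrC mulKr // mulrC.
Qed.

Lemma summable_cauchy_coef (R : comUnitRingType) (a b Q : {fps R}) :
  fcoef a 0 = 0 -> fcoef b 0 = 0 -> summable (cauchy_coef a b Q).
Proof.
move=> a0 b0 n; apply: eqm0Ml; elim: n => [//|n IHn].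
rewrite big_nat_recr //= -addn1; apply: eqm0M => // -[|//] _.
by rewrite fcoefB fcoefM0 a0 b0 mul0r subr0.
Qed.

Lemma cauchy_coef_shift (R : comUnitRingType) (a b Q : {fps R}) n :
  cauchy_coef (a * Q) (b * Q) Q n = Q ^+ n * cauchy_coef a b Q n.
Proof.
rewrite /cauchy_coef mulrA; congr (_ / _).
elim: n => [|n IHn]; first by rewrite !big_geq // mulr1.
by rewrite !big_nat_recr //= IHn exprS; ring.
Qed.

(** Multiplying the n-th term of S(a, b) - S(aQ, bQ) out with
    [cauchy_coefS] leaves b S(a, b) - a S(aQ, bQ). *)
Lemma cauchy_step (R : comUnitRingType) (a b Q : {fps R}) :
  fcoef a 0 = 0 -> fcoef b 0 = 0 -> fcoef Q 0 = 0 ->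
  (1 - b) * fps_sum 0 (cauchy_coef a b Q) =
  (1 - a) * fps_sum 0 (cauchy_coef (a * Q) (b * Q) Q).
Proof.
move=> a0 b0 Q0; set c := cauchy_coef a b Q.
have sc : summable c by apply: summable_cauchy_coef.
rewrite (eq_fps_sum (cauchy_coef_shift a b Q)) -/c.
have sQ : summable (fun n => Q ^+ n * c n) by move=> n; apply: eqm0Mr.
set S := fps_sum 0 c; set S' := fps_sum 0 _.
suff key : S - S' = b * S - a * S'.
  apply/eqP; rewrite -subr_eq0.
  have -> : (1 - b) * S - (1 - a) * S' = (S - S') - (b * S - a * S') by ring.
  by rewrite key subrr.
rewrite -(fps_sumB sc sQ) fps_sum_recl; last first.
  by move=> n; rewrite -[X in eqm _ _ X](subr0 0); apply: eqmB.
rewrite mul1r subrr add0r -(fps_sumMl b sc) -(fps_sumMl a sQ).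
rewrite -fps_sumB; [|exact: summableMl|exact: summableMl].
apply: eq_fps_sum => n.
by have := cauchy_coefS a b n Q0; rewrite -/c; rewrite mulrBr mulr1 [c n.+1 * _]mulrC => ->; ring.
Qed.

(** The sum S(a, b) of the series satisfies (1 - b) S(a, b) =
    (1 - a) S(aQ, bQ) by [cauchy_step], and S(a Q^N, b Q^N) tends to 1;
    iterating N times and letting N grow gives the quotient of products. *)
Theorem cauchy_identity (R : comUnitRingType) (a b Q : {fps R}) :
  fcoef a 0 = 0 -> fcoef b 0 = 0 -> fcoef Q 0 = 0 ->
  fps_sum 0 (cauchy_coef a b Q) = qpoch_inf a Q / qpoch_inf b Q.
Proof.
move=> a0 b0 Q0.
have z0 (x y : {fps R}) : fcoef x 0 = 0 -> fcoef (x * y) 0 = 0.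
  by move=> x0; rewrite fcoefM0 x0 mul0r.
have iter N : qpoch b Q N * fps_sum 0 (cauchy_coef a b Q) =
    qpoch a Q N * fps_sum 0 (cauchy_coef (a * Q ^+ N) (b * Q ^+ N) Q).
  elim: N => [|N IHN]; first by rewrite !qpoch0 !mul1r !mulr1.
  rewrite !qpochS mulrAC IHN -!mulrA; congr (_ * _).
  by rewrite mulrC cauchy_step ?z0 // -!mulrA -!exprSr.
apply: (@mulrI _ (qpoch_inf b Q)); first exact: qpoch_inf_unit.
rewrite mulrCA mulrV ?qpoch_inf_unit // mulr1; apply: eqmP => N.
apply: (@eqm_trans _ _ (qpoch b Q N * fps_sum 0 (cauchy_coef a b Q))).
  by apply: eqmM => //; apply: qpoch_inf_eqm.
rewrite iter -[X in eqm _ _ X]mulr1; apply: eqmM.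
  by apply: eqm_sym; apply: qpoch_inf_eqm.
rewrite fps_sum_recl; last by apply: summable_cauchy_coef; rewrite z0.
rewrite -[X in eqm _ _ X](addr0 1); apply: eqmD.
  by rewrite /cauchy_coef big_geq // qpoch0 divr1.
have s n : eqm (N + n) (cauchy_coef (a * Q ^+ N) (b * Q ^+ N) Q n.+1) 0.
  rewrite /cauchy_coef big_nat_recl //=; apply: eqm0Ml.
  rewrite expr0 mulr1 -mulrBl mulrC mulrA addnC; apply: eqm0M; last exact: eqm0X.
  apply: eqm0Ml; elim: n => [|n IHn]; first by rewrite big_geq.
  rewrite big_nat_recr //= -[n.+1]addn1; apply: eqm0M => // -[|//] _.
  by rewrite fcoefB !z0 ?subr0.
apply: fps_sum_eqm0 => n; last by apply: eqm_leq (s n); apply: leq_addr.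
by apply: eqm_leq (s n); apply: leq_addl.
Qed.

(** * The substitution of q^2 for q *)

Definition fps_sq (R : comUnitRingType) (f : {fps R}) : {fps R} :=
  Fps (fun n => if (2 %| n)%N then fcoef f (n %/ 2) else 0).

Lemma fcoef_fps_sq (R : comUnitRingType) (f : {fps R}) n N : (n < N)%N ->
  fcoef (fps_sq f) n = (fps_trunc N f \Po 'X^2)`_n.
Proof.
move=> nN; rewrite coef_comp_poly_Xn //=; case: ifP => // _.
by rewrite coef_fps_trunc // (leq_ltn_trans (leq_div _ _)).
Qed.

Fact fps_sq_zmod (R : comUnitRingType) : zmod_morphism (@fps_sq R).
Proof.
by move=> f g; apply/fpsP => n /=; case: ifP => // _; rewrite subr0.
Qed.

Fact fps_sq_monoid (R : comUnitRingType) : monoid_morphism (@fps_sq R).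
Proof.
split.
  apply/fpsP => n /=; case: ifP => n2; last by case: n n2.
  by congr (nat_of_bool _)%:R; lia.
move=> f g; apply/fpsP => n.
have -> : fcoef (fps_sq (f * g)) n =
    ((fps_trunc n.+1 f * fps_trunc n.+1 g) \Po 'X^2)`_n.
  rewrite coef_comp_poly_Xn //=; case: ifP => // _.
  by rewrite -fcoef_fps_mul // ltnS leq_div.
rewrite comp_polyM coefM fcoefM; apply: eq_bigr => i _.
by rewrite -!fcoef_fps_sq // ltnS ?leq_subr.
Qed.

HB.instance Definition _ (R : comUnitRingType) :=
  GRing.isZmodMorphism.Build {fps R} {fps R} (@fps_sq R) (@fps_sq_zmod R).
HB.instance Definition _ (R : comUnitRingType) :=
  GRing.isMonoidMorphism.Build {fps R} {fps R} (@fps_sq R) (@fps_sq_monoid R).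

Lemma fps_sq_eqm (R : comUnitRingType) N (f g : {fps R}) :
  eqm N f g -> eqm N (fps_sq f) (fps_sq g).
Proof.
move=> fg m mN /=; case: ifP => // _; apply: fg.
exact: leq_ltn_trans (leq_div _ _) mN.
Qed.

Lemma fps_sqX (R : comUnitRingType) : fps_sq (fpsX R) = fpsX R ^+ 2.
Proof.
apply/fpsP => n; rewrite -[fpsX R ^+ 2]mulr1 fcoefXnM fcoef1 /=.
have [n2|n2] := ltnP n 2; first by case: n n2 => [|[]].
case: ifP => n2'; last by case: eqP => //; lia.
by congr (nat_of_bool _)%:R; lia.
Qed.

(** The substitution is continuous, hence commutes with infinite sums; the same
    holds for products below. *)
Lemma fps_sq_sum (R : comUnitRingType) (F : nat -> {fps R}) : summable F ->
  fps_sq (fps_sum 0 F) = fps_sum 0 (fun n => fps_sq (F n)).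
Proof.
move=> sF; apply/esym/fps_sumP => [n|N].
  by rewrite -[X in eqm _ _ X](rmorph0 (@fps_sq R)); apply: fps_sq_eqm.
rewrite -rmorph_sum; apply: fps_sq_eqm; apply: eqm_sym.
exact: fps_sum_eqm.
Qed.

Lemma fps_sq_qpoch (R : comUnitRingType) (a Q : {fps R}) n :
  fps_sq (qpoch a Q n) = qpoch (fps_sq a) (fps_sq Q) n.
Proof.
by rewrite rmorph_prod; apply: eq_bigr => k _; rewrite rmorphB rmorph1 rmorphM rmorphXn.
Qed.

Lemma fps_sq_qpoch_inf (R : comUnitRingType) (a Q : {fps R}) :
  fcoef a 0 = 0 -> fcoef Q 0 = 0 ->
  fps_sq (qpoch_inf a Q) = qpoch_inf (fps_sq a) (fps_sq Q).
Proof.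
move=> a0 Q0; apply: eqmP => N.
apply: eqm_trans (fps_sq_eqm (qpoch_inf_eqm a0 Q0 (leqnn N))) _.
by rewrite fps_sq_qpoch; apply: eqm_sym; apply: qpoch_inf_eqm.
Qed.

(** * Euler's expansions and the q-binomial theorem *)

Lemma qpoch_inf0 (R : comUnitRingType) (Q : {fps R}) :
  fcoef Q 0 = 0 -> qpoch_inf 0 Q = 1.
Proof. by move=> Q0; apply: eqmP => N; apply: qpoch_inf_eqm1. Qed.

Lemma euler_inv (R : comUnitRingType) (b Q : {fps R}) :
  fcoef b 0 = 0 -> fcoef Q 0 = 0 ->
  (qpoch_inf b Q)^-1 = fps_sum 0 (fun n => b ^+ n / qpoch Q Q n).
Proof.
move=> b0 Q0; rewrite -[LHS]mul1r -{1}(qpoch_inf0 Q0) -cauchy_identity //.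
apply: eq_fps_sum => n; rewrite /cauchy_coef; congr (_ / _).
rewrite -[RHS]mulr1 -[n in b ^+ n]subn0 -prodr_const_nat mulr1.
by apply: eq_bigr => k _; rewrite mul0r subr0.
Qed.

Lemma euler_prod (R : comUnitRingType) (a Q : {fps R}) :
  fcoef a 0 = 0 -> fcoef Q 0 = 0 ->
  qpoch_inf a Q =
  fps_sum 0 (fun n => (- a) ^+ n * Q ^+ 'C(n, 2) / qpoch Q Q n).
Proof.
move=> a0 Q0; rewrite -[LHS]mulr1 -invr1 -{1}(qpoch_inf0 Q0) -cauchy_identity //.
apply: eq_fps_sum => n; rewrite /cauchy_coef; congr (_ / _).
elim: n => [|n IHn]; first by rewrite big_geq // mulr1.
by rewrite big_nat_recr //= IHn binS bin1 exprD exprS; ring.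
Qed.

Lemma q_binomial (R : comUnitRingType) (a z Q : {fps R}) :
  fcoef z 0 = 0 -> fcoef Q 0 = 0 ->
  fps_sum 0 (fun n => qpoch a Q n / qpoch Q Q n * z ^+ n) =
  qpoch_inf (a * z) Q / qpoch_inf z Q.
Proof.
move=> z0 Q0; rewrite -cauchy_identity //; last by rewrite fcoefM0 z0 mulr0.
apply: eq_fps_sum => n; rewrite /cauchy_coef mulrAC; congr (_ / _).
elim: n => [|n IHn]; first by rewrite big_geq // qpoch0 mulr1.
by rewrite big_nat_recr //= -IHn qpochS exprS; ring.
Qed.


Lemma coef0X (R : comUnitRingType) (q : {fps R}) n :
  fcoef q 0 = 0 -> fcoef (q ^+ n.+1) 0 = 0.
Proof. by move=> q0; rewrite exprS fcoefM0 q0 mul0r. Qed.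

Lemma coef0N (R : comUnitRingType) (f : {fps R}) :
  fcoef f 0 = 0 -> fcoef (- f) 0 = 0.
Proof. by move=> f0; rewrite fcoefN f0 oppr0. Qed.

Lemma qpoch_infq (R : comUnitRingType) (q : {fps R}) k : fcoef q 0 = 0 ->
  qpoch_inf q q = qpoch q q k * qpoch_inf (q ^+ k.+1) q.
Proof. by move=> q0; rewrite (@qpoch_infD _ _ _ k) // -(exprS q k). Qed.

Lemma qpoch_infNq (R : comUnitRingType) (q : {fps R}) k : fcoef q 0 = 0 ->
  qpoch_inf (- q) q = qpoch (- q) q k * qpoch_inf (- q ^+ k.+1) q.
Proof. by move=> q0; rewrite (@qpoch_infD _ _ _ k) ?coef0N // mulNr -(exprS q k). Qed.

(** * Expanding lambda in infinite products *)

Definition bterm (R : comUnitRingType) (q : {fps R}) (k : nat) : {fps R} :=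
  q ^+ k * qpoch_inf (q ^+ k.+1) q * qpoch_inf (- q ^+ k.+2) (q ^+ 2)
    / qpoch_inf (- q ^+ k.+1) (q ^+ 2).

Lemma summable_bterm (R : comUnitRingType) (q : {fps R}) :
  fcoef q 0 = 0 -> summable (bterm q).
Proof.
by move=> q0 n; rewrite /bterm -!mulrA; apply: eqm0Ml; apply: eqm0X.
Qed.

(** Both sides are the double series obtained by expanding 1/(e q^(n+1);q)_oo
    in powers of e: summing over k first gives the left-hand side, summing over
    n first gives a q-binomial series with base q^2, whose value is the
    quotient of products in [bterm]. *)
Lemma bterm_sum (R : comUnitRingType) (e q : {fps R}) : fcoef q 0 = 0 ->
  fps_sum 0 (fun n => (-1) ^+ n * q ^+ n * qpoch q (q ^+ 2) n
     / qpoch (q ^+ 2) (q ^+ 2) n * qpoch_inf q q / qpoch_inf (e * q ^+ n.+1) q)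
  = fps_sum 0 (fun k => e ^+ k * bterm q k).
Proof.
move=> q0; have qS n : fcoef (q ^+ n.+1) 0 = 0 by apply: coef0X.
have NqS n : fcoef (- q ^+ n.+1) 0 = 0 by apply: coef0N.
pose c n : {fps R} := (-1) ^+ n * q ^+ n * qpoch q (q ^+ 2) n
     / qpoch (q ^+ 2) (q ^+ 2) n * qpoch_inf q q.
pose F n k : {fps R} := c n * ((e * q ^+ n.+1) ^+ k / qpoch q q k).
have z0 n : fcoef (e * q ^+ n.+1) 0 = 0 by rewrite fcoefM0 qS mulr0.
transitivity (fps_sum 0 (fun n => fps_sum 0 (fun k => F n k))).
  apply: eq_fps_sum => n; rewrite -/(c n) euler_inv // -fps_sumMl //.
  by move=> k; apply: eqm0Ml; apply: eqm0X.
rewrite fps_sum_exchange; first last.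
- by move=> n k; apply: eqm0Mr; apply: eqm0Ml; apply: eqm0X.
- move=> n k; apply: eqm0Ml; rewrite /c -!mulrA; apply: eqm0Mr.
  by apply: eqm0Ml; apply: eqm0X.
apply: eq_fps_sum => k.
have -> : e ^+ k * bterm q k = e ^+ k * q ^+ k * qpoch_inf (q ^+ k.+1) q *
    (qpoch_inf (q * - q ^+ k.+1) (q ^+ 2) / qpoch_inf (- q ^+ k.+1) (q ^+ 2)).
  rewrite mulrN -(exprS q k.+1) /bterm.
  by move: (_ ^+ k) (_ ^+ k) (qpoch_inf _ _) (qpoch_inf _ _) (_^-1) => *; ring.
rewrite -q_binomial // -fps_sumMl; last by move=> n; apply: eqm0Mr; apply: eqm0X.
apply: eq_fps_sum => n; rewrite /F /c (qpoch_infq k q0).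
have u := @qpoch_unit _ q q k q0.
have -> : (- q ^+ k.+1) ^+ n = (-1) ^+ n * q ^+ n * q ^+ (k * n).
  by rewrite [LHS]exprNn -exprM mulSn exprD mulrA.
have -> : (e * q ^+ n.+1) ^+ k = e ^+ k * q ^+ k * q ^+ (k * n).
  by rewrite exprMn -exprM mulSn exprD mulrA mulnC.
move: (qpoch q q k) u (qpoch_inf _ _) (qpoch q _ _) (qpoch (q ^+ 2) _ _) => A u B C D.
transitivity (e ^+ k * q ^+ k * B * (C / D * ((-1) ^+ n * q ^+ n * q ^+ (k * n))) * (A / A)).
  by move: (_ ^+ k) (_ ^+ k) (_ ^+ n) (_ ^+ n) (_ ^+ (k * n)) => ? ? ? ? ?; ring.
by rewrite mulrV // mulr1.
Qed.

(** The case e = 1, since (q;q)_oo/(q^(n+1);q)_oo = (q;q)_n and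
    (q^2;q^2)_n = (q;q)_n (-q;q)_n. *)
Lemma lambda6_bterm (R : comUnitRingType) (q : {fps R}) : fcoef q 0 = 0 ->
  fps_sum 0 (fun n => (-1) ^+ n * q ^+ n * qpoch q (q ^+ 2) n / qpoch (- q) q n)
  = fps_sum 0 (bterm q).
Proof.
move=> q0; have qS n : fcoef (q ^+ n.+1) 0 = 0 by apply: coef0X.
transitivity (fps_sum 0 (fun k => 1 ^+ k * bterm q k)); last first.
  by apply: eq_fps_sum => k; rewrite expr1n mul1r.
rewrite -bterm_sum //; apply: eq_fps_sum => n.
rewrite mul1r (qpoch_infq n q0) -qpochNM invrM ?qpoch_unit ?coef0N //.
have u1 := @qpoch_unit _ q q n q0.
have u2 : qpoch_inf (q ^+ n.+1) q \is a GRing.unit by apply: qpoch_inf_unit.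
move: (qpoch q q n) u1 (qpoch_inf _ _) u2 ((-1) ^+ n) (q ^+ n) (qpoch q _ _)
  (qpoch (- q) _ _) => A uA B uB x y C D.
transitivity (x * y * C / D * (A / A) * (B / B)); last by ring.
by rewrite !mulrV // !mulr1.
Qed.

(** The case e = -1, where (-q;q)_n cancels instead of (q;q)_n and the mock
    theta function is replaced by a series of Rogers-Ramanujan type. *)
Lemma bterm_alternating (R : comUnitRingType) (q : {fps R}) : fcoef q 0 = 0 ->
  fps_sum 0 (fun k => (-1) ^+ k * bterm q k) =
  qpoch_inf q q / qpoch_inf (- q) q *
  fps_sum 0 (fun n => (-1) ^+ n * q ^+ n * qpoch q (q ^+ 2) n / qpoch q q n).
Proof.
move=> q0; have NqS n : fcoef (- q ^+ n.+1) 0 = 0 by apply/coef0N/coef0X.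
rewrite -bterm_sum // -fps_sumMl; last first.
  by move=> n; rewrite -!mulrA; apply: eqm0Mr; apply: eqm0Ml; apply: eqm0X.
apply: eq_fps_sum => n.
rewrite mulN1r (qpoch_infNq n q0) -qpochNM.
have u1 : qpoch q q n \is a GRing.unit by apply: qpoch_unit.
have u0 : qpoch (- q) q n \is a GRing.unit by apply/qpoch_unit/coef0N.
have u2 : qpoch_inf (- q ^+ n.+1) q \is a GRing.unit by apply: qpoch_inf_unit.
rewrite !invrM //.
move: (qpoch q q n) (qpoch (- q) q n) (qpoch_inf q q) (qpoch_inf _ _) (_ ^+ n)
  (_ ^+ n) (qpoch _ _ _) => *; ring.
Qed.

(** * The odd-indexed terms and psi *)

(** Expand (q^(2m+3);q^2)_oo on the right by Euler's theorem and sum over m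
    first: the inner series is sum_m (-q;q)_m/(q;q)_m q^((2n+1)m), which the
    q-binomial theorem evaluates as (-q^(2n+2);q)_oo/(q^(2n+1);q)_oo. *)
Lemma psi6_product_sum (R : comUnitRingType) (q : {fps R}) : fcoef q 0 = 0 ->
  fps_sum 0 (fun n => (-1) ^+ n * q ^+ ((n + 1) ^ 2) * qpoch q (q ^+ 2) n
                      / qpoch (- q) q (2 * n + 1)) =
  fps_sum 0 (fun m => q ^+ m.+1 * qpoch_inf (q ^+ m.+1) q
    * qpoch_inf (q ^+ (2 * m).+3) (q ^+ 2) / qpoch_inf (- q ^+ m.+1) q).
Proof.
move=> q0; have qS n : fcoef (q ^+ n.+1) 0 = 0 by apply: coef0X.
have Nq0 : fcoef (- q) 0 = 0 by apply: coef0N.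
have NqS n : fcoef (- q ^+ n.+1) 0 = 0 by apply: coef0N.
pose F m n : {fps R} := q ^+ m.+1 * qpoch_inf (q ^+ m.+1) q
     / qpoch_inf (- q ^+ m.+1) q *
    ((- q ^+ (2 * m).+3) ^+ n * q ^+ 2 ^+ 'C(n, 2) / qpoch (q ^+ 2) (q ^+ 2) n).
transitivity (fps_sum 0 (fun m => fps_sum 0 (F m))); last first.
  apply: eq_fps_sum => m; rewrite mulrAC (@euler_prod _ (q ^+ (2 * m).+3) (q ^+ 2)) // -fps_sumMl //.
  by move=> n; rewrite -mulrA; apply: eqm0Ml; apply: eqm0X.
rewrite fps_sum_exchange; first last.
- by move=> m n; apply: eqm0Mr; rewrite -mulrA; apply: eqm0Ml; apply: eqm0X.
- move=> m n; rewrite /F -!mulrA; apply: eqm0Ml.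
  by apply: eqm_leq (leqnSn m) _; apply: eqm0X.
apply: eq_fps_sum => n; apply/esym.
have uq k : qpoch q q k \is a GRing.unit by apply: qpoch_unit.
have uQ k : qpoch (- q) q k \is a GRing.unit by apply: qpoch_unit.
have vq k : qpoch_inf (q ^+ k.+1) q \is a GRing.unit by apply: qpoch_inf_unit.
have vQ k : qpoch_inf (- q ^+ k.+1) q \is a GRing.unit by apply: qpoch_inf_unit.
pose c : {fps R} := (-1) ^+ n * q ^+ ((n + 1) ^ 2) / qpoch (q ^+ 2) (q ^+ 2) n
  * (qpoch_inf q q / qpoch_inf (- q) q).
transitivity (fps_sum 0 (fun m => c *
    (qpoch (- q) q m / qpoch q q m * (q ^+ (2 * n).+1) ^+ m))).
  apply: eq_fps_sum => m; rewrite /F /c (qpoch_infq m q0) (qpoch_infNq m q0).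
  rewrite invrM //.
  have -> : (- q ^+ (2 * m).+3) ^+ n = (-1) ^+ n * q ^+ (2 * m * n + 3 * n).
    by rewrite [LHS]exprNn -exprM -addn3 mulnDl.
  have -> : q ^+ 2 ^+ 'C(n, 2) = q ^+ (n * n.-1).
    by rewrite -exprM mul_bin_left bin1 subn1 mulnC.
  have e : q ^+ m.+1 * q ^+ (2 * m * n + 3 * n) * q ^+ (n * n.-1) =
            q ^+ ((n + 1) ^ 2) * q ^+ (2 * n).+1 ^+ m.
    rewrite -exprM -!exprD; congr (_ ^+ _).
    by case: (n) => [|k]; rewrite -?mulnn /=; lia.
  transitivity ((-1) ^+ n * (q ^+ m.+1 * q ^+ (2 * m * n + 3 * n) * q ^+ (n * n.-1))
    / qpoch (q ^+ 2) (q ^+ 2) n * qpoch_inf (q ^+ m.+1) q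
    / qpoch_inf (- q ^+ m.+1) q).
    move: (_ ^+ n) (q ^+ m.+1) (q ^+ _) (q ^+ (n * _)) (_^-1) (_^-1) => x y z t u v.
    by ring.
  rewrite e; move: (qpoch q q m) (qpoch (- q) q m) (uq m) (uQ m) => A B uA uB.
  move: (qpoch_inf (q ^+ _) _) (qpoch_inf (- q ^+ _) _) (qpoch _ _ _) => C D E.
  move: ((-1) ^+ n) (_ ^+ m) (q ^+ ((n + 1) ^ 2)) => x y z.
  transitivity (x * (z * y) / E * C / D * (A / A) * (B / B)); last by ring.
  by rewrite !mulrV // !mulr1.
rewrite fps_sumMl; last by move=> m; apply: eqm0Mr; apply: eqm0X.
rewrite q_binomial // /c mulNr -(exprS q (2 * n).+1) (qpoch_infq (2 * n) q0).
rewrite (qpoch_infNq (2 * n).+1 q0).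
rewrite invrM // qpoch_dissect2 -expr2 (addn1 (2 * n)).
have uQn : qpoch (q ^+ 2) (q ^+ 2) n \is a GRing.unit by apply: qpoch_unit.
move: (qpoch (q ^+ 2) (q ^+ 2) n) uQn (qpoch_inf _ _) (vq (2 * n)%N)
  (qpoch_inf (- _) _) (vQ (2 * n).+1) => A uA B uB C uC.
move: (qpoch q (q ^+ 2) n) (qpoch (- q) _ _) ((-1) ^+ n) (q ^+ ((n + 1) ^ 2)) => D E x y.
transitivity (x * y * D / E * (A / A) * (B / B) * (C / C)); first by ring.
by rewrite !mulrV // !mulr1.
Qed.

(** For odd k the factors of [bterm] pair up: (q^(2m+2);q)_oo contributes the
    factor (q^(2m+3);q^2)_oo that combines with (-q^(2m+3);q^2)_oo, and
    everything but one power of q becomes a series in q^2. *)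
Lemma bterm_odd (R : comUnitRingType) :
  let q := fpsX R in
  q * fps_sum 0 (fun m => bterm q (2 * m + 1)) = fps_sq
  (fps_sum 0 (fun n => (-1) ^+ n * q ^+ ((n + 1) ^ 2) * qpoch q (q ^+ 2) n
                      / qpoch (- q) q (2 * n + 1))).
Proof.
move=> q; have q0 : fcoef q 0 = 0 by [].
have sqq : fps_sq q = q ^+ 2 by apply: fps_sqX.
move: q q0 sqq => q q0 sqq.
have qS n : fcoef (q ^+ n.+1) 0 = 0 by apply: coef0X.
have Nq0 : fcoef (- q) 0 = 0 by apply: coef0N.
have NqS n : fcoef (- q ^+ n.+1) 0 = 0 by apply: coef0N.
rewrite psi6_product_sum // fps_sq_sum; last first.
  move=> n; rewrite -!mulrA; apply: eqm0Ml.
  by apply: eqm_leq (leqnSn n) _; apply: eqm0X.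
rewrite -fps_sumMl; last first.
  move=> n; apply: (@eqm_leq _ _ (2 * n + 1)%N); last exact: summable_bterm.
  by lia.
apply: eq_fps_sum => m; rewrite /bterm addn1.
have sqX n : fps_sq (q ^+ n) = q ^+ (2 * n) by rewrite rmorphXn /= sqq -exprM.
have sqN n : fps_sq (- q ^+ n) = - q ^+ (2 * n) by rewrite -sqX rmorphN.
have sqM (A A' B B' C C' D D' : {fps R}) : D \is a GRing.unit ->
    fps_sq A = A' -> fps_sq B = B' -> fps_sq C = C' -> fps_sq D = D' ->
    fps_sq (A * B * C / D) = A' * B' * C' / D'.
  by move=> uD <- <- <- <-; rewrite !rmorphM rmorphV.
have sqP n : fps_sq (qpoch_inf (q ^+ n.+1) q) = qpoch_inf (q ^+ (2 * n).+2) (q ^+ 2).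
  by rewrite (fps_sq_qpoch_inf (qS n) q0) sqX sqq mulnS.
have sqNP n : fps_sq (qpoch_inf (- q ^+ n.+1) q) = qpoch_inf (- q ^+ (2 * n).+2) (q ^+ 2).
  by rewrite (fps_sq_qpoch_inf (NqS n) q0) sqN sqq mulnS.
have sqP2 n : fps_sq (qpoch_inf (q ^+ n.+1) (q ^+ 2)) =
    qpoch_inf (q ^+ n.+1) (q ^+ 2) * qpoch_inf (- q ^+ n.+1) (q ^+ 2).
  rewrite (fps_sq_qpoch_inf (qS n) (qS 1%N)) !sqX (qpoch_infNM (qS n) (qS 1%N)).
  by rewrite -!exprM mulnC.
apply: etrans (esym (sqM _ _ _ _ _ _ _ _ _ (sqX _) (sqP _) (sqP2 _) (sqNP _)));
  last exact: qpoch_inf_unit.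
rewrite (@qpoch_inf_dissect2 _ (q ^+ (2 * m).+2) q) // -exprSr.
have -> : q ^+ (2 * m.+1) = q * q ^+ (2 * m).+1 by rewrite -exprS mulnS.
move: (qpoch_inf _ _) (qpoch_inf _ _) (qpoch_inf _ _) (qpoch_inf _ _).
move: (q ^+ (2 * m).+1) => x A B C D.
by ring.
Qed.

(** * The Bailey pair with beta_n = 1/(q;q)_n *)

Lemma eqmV (R : comUnitRingType) N (f g : {fps R}) :
  f \is a GRing.unit -> g \is a GRing.unit -> eqm N f g -> eqm N f^-1 g^-1.
Proof.
move=> uf ug fg.
have -> : f^-1 = f^-1 * g^-1 * g by rewrite -mulrA mulVr // mulr1.
have {2}-> : g^-1 = f^-1 * g^-1 * f by rewrite mulrAC mulVr // mul1r.
by apply: eqmM => //; apply: eqm_sym.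
Qed.

Lemma fps_sum_shift (R : comUnitRingType) (F : nat -> {fps R}) r :
  summable F -> (forall n, (n < r)%N -> F n = 0) ->
  fps_sum 0 F = fps_sum 0 (fun n => F (r + n)%N).
Proof.
move=> sF F0; have sG : summable (fun n => F (r + n)%N).
  by move=> n; apply: (@eqm_leq _ _ (r + n)%N); rewrite ?leq_addl.
apply: eqmP => N; apply: eqm_trans (fps_sum_eqm sF (leq_addl r N)) _.
apply: eqm_sym; apply: eqm_trans (fps_sum_eqm sG (leqnn N)) _.
rewrite (@big_cat_nat _ _ _ r 0 (r + N)) ?leq_addr //= [X in X + _]big1_seq ?add0r.
  by rewrite (big_addn 0 (r + N) r predT F) addKn; under eq_bigr do rewrite addnC.
by move=> i /andP[_]; rewrite mem_index_iota => /andP[_ /F0].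
Qed.

Lemma fps_sum_finite (R : comUnitRingType) (F : nat -> {fps R}) n :
  summable F -> (forall r, (n <= r)%N -> F r = 0) ->
  fps_sum 0 F = \sum_(0 <= r < n) F r.
Proof.
move=> sF F0; apply: eqmP => N.
apply: eqm_trans (fps_sum_eqm sF (leq_addl n N)) _.
rewrite (@big_cat_nat _ _ _ n 0 (n + N)) ?leq_addr //= [X in _ + X]big1_seq ?addr0 //.
by move=> i /andP[_]; rewrite mem_index_iota => /andP[/F0].
Qed.

(** The inverse of (q;q)_(n-r), with the convention that it vanishes for
    r > n: this makes the boundary terms at the top of the telescoping sums
    below vanish. *)
Definition qfact_inv (R : comUnitRingType) (q : {fps R}) n r : {fps R} :=
  if (r <= n)%N then (qpoch q q (n - r))^-1 else 0.

Lemma qfact_invSS (R : comUnitRingType) (q : {fps R}) n r :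
  qfact_inv q n.+1 r.+1 = qfact_inv q n r.
Proof. by []. Qed.

Lemma qpochV_S (R : comUnitRingType) (q : {fps R}) n : fcoef q 0 = 0 ->
  (qpoch q q n)^-1 = (qpoch q q n.+1)^-1 * (1 - q ^+ n.+1).
Proof.
move=> q0; rewrite qpochS -(exprS q n).
have u : 1 - q ^+ n.+1 \is a GRing.unit.
  by rewrite fps_unitE fcoefB exprS fcoefM0 q0 mul0r subr0 unitr1.
by rewrite (mulrC (qpoch q q n)) invrM ?qpoch_unit // -mulrA mulVr ?mulr1.
Qed.

Lemma qfact_invSr (R : comUnitRingType) (q : {fps R}) n r :
  fcoef q 0 = 0 -> (r <= n)%N ->
  qfact_inv q n r.+1 = qfact_inv q n r * (1 - q ^+ (n - r)).
Proof.
move=> q0 rn; rewrite /qfact_inv rn; case: ltnP => [rn'|nr].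
  by rewrite -(subnSK rn') -qpochV_S.
have -> : (n - r = 0)%N by lia.
by rewrite subrr mulr0.
Qed.

(** Induction on n.  With F(n, r) the summand, (1 - q^n) F(n, r) - F(n-1, r)
    is a difference K(r+1) - K(r), and K vanishes at both ends. *)
Lemma bailey_pair (R : comUnitRingType) (q : {fps R}) n : fcoef q 0 = 0 ->
  (qpoch q q n)^-1 = \sum_(0 <= r < n.+1)
    (-1) ^+ r * q ^+ ('C(r.+1, 2) + r * r) * (1 - q ^+ (2 * r).+1)
      * qfact_inv q n r / qpoch q q (n + r).+1.
Proof.
move=> q0.
pose e r : {fps R} := (-1) ^+ r * q ^+ ('C(r.+1, 2) + r * r).
pose F n r := e r * (1 - q ^+ (2 * r).+1) * qfact_inv q n r / qpoch q q (n + r).+1.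
have Fout k r : (k < r)%N -> F k r = 0.
  by move=> kr; rewrite /F /qfact_inv leqNgt kr /= mulr0 mul0r.
elim: n => [|n IHn].
  rewrite big_nat1 /qfact_inv /= !qpochS !qpoch0 !mul1r invr1 expr1 expr0 !mulr1.
  by rewrite mulrV // fps_unitE fcoefB q0 subr0 unitr1.
pose K r := - (e r * q ^+ (n.+1 - r) * (1 - q ^+ r) * qfact_inv q n.+1 r
                / qpoch q q (n.+1 + r)).
have step r : (r <= n.+1)%N -> (1 - q ^+ n.+1) * F n.+1 r - F n r = K r.+1 - K r.
  move=> rn; rewrite /F /K.
  have -> : qfact_inv q n r = qfact_inv q n.+1 r * (1 - q ^+ (n.+1 - r)).
    by rewrite -qfact_invSr // qfact_invSS.
  have -> : e r.+1 * q ^+ (n.+1 - r.+1) * (1 - q ^+ r.+1) * qfact_inv q n.+1 r.+1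
    = - (e r * q ^+ (3 * r).+1) * (1 - q ^+ r.+1)
      * (qfact_inv q n.+1 r * (1 - q ^+ (n.+1 - r))) * q ^+ (n.+1 - r).
    rewrite -qfact_invSr //; case: (ltnP r n.+1) => rn1; last first.
      by rewrite /qfact_inv ltnNge rn1 /= !(mulr0, mul0r).
    have -> : e r.+1 * q ^+ (n.+1 - r.+1) = - (e r * q ^+ (3 * r).+1) * q ^+ (n.+1 - r).
      rewrite /e exprS mulN1r !mulNr -!mulrA -!exprD; congr (- (_ * _ ^+ _)).
      by rewrite binS bin1; lia.
    by ring.
  rewrite addnS addSn (qpochV_S (n + r).+1 q0).
  have -> : q ^+ (n + r).+2 = q * q ^+ (n.+1 - r) * q ^+ r * q ^+ r.
    by rewrite -exprS -!exprD; congr (_ ^+ _); lia.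
  have -> : q ^+ (2 * r).+1 = q * q ^+ r * q ^+ r.
    by rewrite -exprS -!exprD; congr (_ ^+ _); lia.
  have -> : q ^+ n.+1 = q ^+ (n.+1 - r) * q ^+ r by rewrite -exprD; congr (_ ^+ _); lia.
  have -> : q ^+ (3 * r).+1 = q * q ^+ r * q ^+ r * q ^+ r.
    by rewrite -exprS -!exprD; congr (_ ^+ _); lia.
  rewrite (exprS q r).
  move: (e r) (q ^+ r) (q ^+ (n.+1 - r)) (qfact_inv _ _ _) (qpoch _ _ _)^-1.
  by move=> e' x A i p; ring.
have u : 1 - q ^+ n.+1 \is a GRing.unit.
  by rewrite fps_unitE fcoefB exprS fcoefM0 q0 mul0r subr0 unitr1.
apply: (mulrI u).
transitivity (qpoch q q n)^-1; first by rewrite (qpochV_S n q0) mulrC.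
rewrite IHn; apply/esym/eqP; rewrite -subr_eq0.
rewrite -[X in _ - X]addr0 -{3}(Fout n n.+1 (ltnSn n)) -big_nat_recr //=.
rewrite mulr_sumr -sumrB.
rewrite (eq_big_nat _ _ (F2 := fun r => K r.+1 - K r)); last first.
  by move=> r /andP[_ rn]; apply: step.
rewrite telescope_sumr // /K /qfact_inv ltnn expr0 subrr.
by rewrite !(mulr0, mul0r, oppr0, subr0).
Qed.

(** * The q-Gauss sum *)

Definition gauss_sum (R : comUnitRingType) (q : {fps R}) r : {fps R} :=
  fps_sum 0 (fun t => qpoch q (q ^+ 2) (r + t) * (- q) ^+ t
                      / qpoch q q t / qpoch q q (2 * r + t).+1).

Lemma summable_gauss (R : comUnitRingType) (q : {fps R}) r : fcoef q 0 = 0 ->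
  summable (fun t => qpoch q (q ^+ 2) (r + t) * (- q) ^+ t
                      / qpoch q q t / qpoch q q (2 * r + t).+1).
Proof.
move=> q0 n; rewrite -!mulrA; apply: eqm0Mr; apply: eqm0Ml.
exact/eqm0X/coef0N.
Qed.

(** The two sides differ, when truncated, by the explicit boundary term H N
    below, which tends to 0. *)
Lemma gauss_sumS (R : comUnitRingType) (q : {fps R}) r : fcoef q 0 = 0 ->
  (1 - q ^+ (2 * r).+1) * gauss_sum q r =
  (1 - q ^+ (2 * r).+3) * gauss_sum q r.+1.
Proof.
move=> q0.
pose u r t := qpoch q (q ^+ 2) (r + t) * (- q) ^+ t
                / qpoch q q t / qpoch q q (2 * r + t).+1.
pose H N := (1 - q ^+ (2 * r).+2) * qpoch q (q ^+ 2) (r + N).+1 * (- q) ^+ N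
                / qpoch q q N / qpoch q q (2 * r + N).+2.
have partial N : (1 - q ^+ (2 * r).+1) * \sum_(0 <= t < N.+1) u r t
   - (1 - q ^+ (2 * r).+3) * \sum_(0 <= t < N) u r.+1 t = H N.
  elim: N => [|N IHN].
    rewrite big_nat1 big_geq // mulr0 subr0 /u /H !addn0 !expr0 !qpoch0 !mulr1 !divr1.
    rewrite (qpochV_S (2 * r).+1 q0) (qpochS q (q ^+ 2)) -exprM -(exprS q (2 * r)).
    move: (q ^+ _) (q ^+ _) (qpoch _ _ _) (_^-1) => a b c d; by ring.
  rewrite big_nat_recr // [X in _ - _ * X]big_nat_recr //=.
  have -> : H N.+1 = H N + ((1 - q ^+ (2 * r).+1) * u r N.+1
                            - (1 - q ^+ (2 * r).+3) * u r.+1 N).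
    rewrite /H /u.
    have -> : (2 * r.+1 + N).+1 = (2 * r + N).+3 by lia.
    rewrite !addnS addSn (qpochS q (q ^+ 2) (r + N).+1) -exprM.
    rewrite (qpochV_S N q0) (qpochV_S (2 * r + N).+2 q0).
    have -> : q * q ^+ (2 * (r + N).+1) = q ^+ 3 * q ^+ (2 * r) * q ^+ N * q ^+ N.
      by rewrite -exprS -!exprD; congr (_ ^+ _); lia.
    have -> : q ^+ (2 * r + N).+3 = q ^+ 3 * q ^+ (2 * r) * q ^+ N.
      by rewrite -!exprD; congr (_ ^+ _); lia.
    rewrite (exprS q (2 * r)) (exprS q (2 * r).+1) (exprS q (2 * r).+2).
    rewrite (exprS q (2 * r)) (exprS q (2 * r).+1) (exprS q N) (exprS (- q) N).
    rewrite (exprS q (2 * r)) (exprSr q 2) (exprSr q 1) expr1.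
    move: (qpoch q (q ^+ 2) _) (qpoch q q N.+1)^-1 (qpoch q q (2 * r + N).+3)^-1.
    move: ((- q) ^+ N) (q ^+ (2 * r)) (q ^+ N) => w y s a b c.
    by ring.
  rewrite -IHN; move: (\sum_(_ <= _ < _) _) (\sum_(_ <= _ < _) _) (u _ _) (u _ _).
  by move=> a b c d; ring.
apply: eqmP => N.
have sg := summable_gauss _ q0.
apply: (@eqm_trans _ _ ((1 - q ^+ (2 * r).+1) * \sum_(0 <= t < N.+1) u r t)).
  by apply: eqmM => //; apply: fps_sum_eqm => //; apply: sg.
apply: eqm_sym.
apply: (@eqm_trans _ _ ((1 - q ^+ (2 * r).+3) * \sum_(0 <= t < N) u r.+1 t)).
  by apply: eqmM => //; apply: fps_sum_eqm => //; apply: sg.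
have -> : (1 - q ^+ (2 * r).+1) * \sum_(0 <= t < N.+1) u r t =
    H N + (1 - q ^+ (2 * r).+3) * \sum_(0 <= t < N) u r.+1 t.
  by rewrite -partial subrK.
rewrite -{1}[X in eqm _ X _]add0r; apply: eqmD => //; apply: eqm_sym.
rewrite /H -!mulrA; do 2 apply: eqm0Mr; apply: eqm0Ml.
exact/eqm0X/coef0N.
Qed.

(** A case of the q-Gauss sum with parameters q^(r+1/2) and -q^(r+1/2).
    By [gauss_sumS] the left-hand side is the same for all r, and as r grows
    the series becomes (q;q^2)_oo/(q;q)_oo times Euler's series for
    1/(-q;q)_oo. *)
Lemma gauss_sumE (R : comUnitRingType) (q : {fps R}) r : fcoef q 0 = 0 ->
  (1 - q ^+ (2 * r).+1) * gauss_sum q r =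
  qpoch_inf q (q ^+ 2) / qpoch_inf (q ^+ 2) (q ^+ 2).
Proof.
move=> q0; have Nq0 := coef0N q0; have q20 := coef0X 1 q0.
have const n : (1 - q ^+ (2 * r).+1) * gauss_sum q r =
    (1 - q ^+ (2 * (r + n)).+1) * gauss_sum q (r + n).
  elim: n => [|n ->]; first by rewrite addn0.
  by rewrite addnS mulnS !addSn add0n; apply: gauss_sumS.
have uN := qpoch_inf_unit Nq0 q0; have u := qpoch_inf_unit q0 q0.
have -> : qpoch_inf q (q ^+ 2) / qpoch_inf (q ^+ 2) (q ^+ 2) =
    1 * (qpoch_inf q (q ^+ 2) / qpoch_inf q q / qpoch_inf (- q) q).
  by rewrite -qpoch_infNM // invrM // mul1r mulrAC mulrA.
rewrite (euler_inv Nq0 q0) -fps_sumMl; last by move=> t; apply: eqm0Ml; apply: eqm0X.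
apply: eqmP => N; rewrite (const N); apply: eqmM.
  rewrite -[X in eqm _ _ X](subr0 1); apply: eqmB => //.
  by apply: (@eqm_leq _ _ (2 * (r + N)).+1); [lia | apply: eqm0X].
apply: eqm_trans (fps_sum_eqm (summable_gauss _ q0) (leqnn N)) _.
set c := _ / _; have sE : summable (fun t => c * ((- q) ^+ t / qpoch q q t)).
  by move=> t; apply: eqm0Mr; apply: eqm0Ml; apply: eqm0X.
apply: eqm_sym; apply: eqm_trans (fps_sum_eqm sE (leqnn N)) _.
apply: eqm_sym; apply: eqm_sum => t _; rewrite /c.
have -> : qpoch q (q ^+ 2) (r + N + t) * (- q) ^+ t / qpoch q q t
    / qpoch q q (2 * (r + N) + t).+1 =
  qpoch q (q ^+ 2) (r + N + t) / qpoch q q (2 * (r + N) + t).+1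
   * ((- q) ^+ t / qpoch q q t).
  move: (qpoch q (q ^+ 2) _) (qpoch q q t)^-1 (qpoch q q _)^-1 ((- q) ^+ t).
  by move=> a b x d; ring.
apply: eqmM => //; apply: eqmM.
  by apply: eqm_sym; apply: qpoch_inf_eqm => //; lia.
apply: eqmV; rewrite ?qpoch_unit //.
by apply: eqm_sym; apply: qpoch_inf_eqm => //; lia.
Qed.

(** * The alternating sum as a theta series *)

(** Bailey's lemma for this pair: replace 1/(q;q)_n by its expansion
    [bailey_pair], exchange the sums, and evaluate the inner one by
    [gauss_sumE], which cancels the factor 1 - q^(2r+1). *)
Theorem alternating_theta (R : comUnitRingType) (q : {fps R}) : fcoef q 0 = 0 ->
  fps_sum 0 (fun n => (-1) ^+ n * q ^+ n * qpoch q (q ^+ 2) n / qpoch q q n) =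
  qpoch_inf q (q ^+ 2) / qpoch_inf (q ^+ 2) (q ^+ 2) *
  fps_sum 0 (fun r => q ^+ (3 * 'C(r.+1, 2))).
Proof.
move=> q0; have Nq0 := coef0N q0.
pose a r := (-1) ^+ r * q ^+ ('C(r.+1, 2) + r * r) * (1 - q ^+ (2 * r).+1).
pose v n r := qpoch q (q ^+ 2) n * (- q) ^+ n * qfact_inv q n r / qpoch q q (n + r).+1.
have av r : eqm r (a r) 0.
  rewrite /a -mulrA; apply: eqm0Mr; apply: eqm0Ml.
  apply: (@eqm_leq _ _ ('C(r.+1, 2) + r * r)%N); last exact: eqm0X.
  by rewrite (leq_trans _ (leq_addl _ _)) //; case: r => // r; rewrite leq_pmull.
have vn n r : eqm n (v n r) 0.
  by rewrite /v -!mulrA; apply: eqm0Mr; apply: eqm0Ml; apply: eqm0X.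
have vout n r : (n < r)%N -> v n r = 0.
  by move=> nr; rewrite /v /qfact_inv leqNgt nr /= mulr0 mul0r.
transitivity (fps_sum 0 (fun n => fps_sum 0 (fun r => a r * v n r))).
  apply: eq_fps_sum => n; rewrite (@fps_sum_finite _ _ n.+1); first last.
  - by move=> r nr; rewrite vout // mulr0.
  - by move=> r; apply: eqm0Ml.
  rewrite bailey_pair // mulr_sumr; apply: eq_bigr => r _.
  rewrite /v (exprNn q n) /a; move: (qpoch q (q ^+ 2) n) (qpoch _ _ _)^-1.
  move: ((-1) ^+ n) (q ^+ n) ((-1) ^+ r) (q ^+ ('C(_, _) + _)) (q ^+ (2 * r).+1).
  by move: (qfact_inv _ _ _) => x1 x2 x3 x4 x5 x6 x7 x8; ring.
rewrite fps_sum_exchange; first last.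
- by move=> n r; apply: eqm0Ml.
- by move=> n r; apply: eqm0Mr.
rewrite -fps_sumMl; last first.
  move=> r; apply: (@eqm_leq _ _ (3 * 'C(r.+1, 2))); last exact: eqm0X.
  by rewrite binS bin1; lia.
apply: eq_fps_sum => r.
rewrite fps_sumMl // (fps_sum_shift _ (vout^~ r)) //.
have -> : fps_sum 0 (fun t => v (r + t)%N r) = (- q) ^+ r * gauss_sum q r.
  rewrite -fps_sumMl; last exact: summable_gauss.
  apply: eq_fps_sum => t; rewrite /v /qfact_inv leq_addr addKn exprD.
  have -> : (r + t + r = 2 * r + t)%N by lia.
  move: (qpoch q (q ^+ 2) _) (qpoch q q t)^-1 (qpoch q q _)^-1 ((- q) ^+ t).
  by move: ((- q) ^+ r) => x1 x2 x3 x4 x5; ring.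
rewrite -(gauss_sumE r q0) /a (exprNn q r).
have -> : q ^+ (3 * 'C(r.+1, 2)) = q ^+ ('C(r.+1, 2) + r * r) * q ^+ r.
  rewrite -exprD; congr (_ ^+ _).
  by have := mul_bin_left r.+1 1; rewrite bin1 subn1 /=; lia.
have s1 : (-1) ^+ r * (-1) ^+ r = 1 :> {fps R} by rewrite -expr2 sqrr_sign.
move: ((-1) ^+ r) s1 (q ^+ ('C(_, _) + _)) (q ^+ r) (q ^+ (2 * r).+1) (gauss_sum q r).
move=> s s1 x y z g; rewrite -[RHS]mul1r -s1.
by ring.
Qed.

(** * Generating series of weighted sets *)

(** A sum over an infinite fiber is 0 by convention, so the rules below for
    sums, products and disjoint unions are stated for finite fibers. *)
Definition wseries (I : choiceType) (w : I -> int) (e : I -> nat) : {fps int} :=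
  Fps (fun N => \sum_(k \in [set k | e k = N]%classic) w k).

Definition finite_fibers (I : choiceType) (e : I -> nat) :=
  forall N, finite_set [set k | (e k <= N)%N]%classic.

Lemma finite_fiber (I : choiceType) (e : I -> nat) N :
  finite_fibers e -> finite_set [set k | e k = N]%classic.
Proof. by move=> fe; apply: sub_finite_set (fe N) => k /= ->. Qed.

Lemma wseries_coef (I : choiceType) (w : I -> int) (e : I -> nat) (s : seq I) N i :
  uniq s -> (forall k, (e k <= N)%N -> k \in s) -> (i <= N)%N ->
  fcoef (wseries w e) i = \sum_(k <- s | e k == i) w k.
Proof.
move=> us sE iN; rewrite -big_filter /=.
apply: fsbig_fwiden => [k /= ek||k /= [+ ek]]; last 2 first.
- exact: filter_uniq.
- by rewrite mem_filter => /andP[/eqP /ek].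
by rewrite mem_filter ek eqxx sE // ek.
Qed.

Lemma wseries_cover (I : choiceType) (e : I -> nat) N : finite_fibers e ->
  exists2 s : seq I, uniq s & forall k, (e k <= N)%N -> k \in s.
Proof.
move=> /(_ N)/finite_seqP[s sE]; exists (undup s); first exact: undup_uniq.
move=> k ek; rewrite mem_undup.
by have : [set k | (e k <= N)%N]%classic k by []; rewrite sE.
Qed.

Lemma wseriesM (I J : choiceType) (w : I -> int) (e : I -> nat)
    (w' : J -> int) (e' : J -> nat) :
  finite_fibers e -> finite_fibers e' ->
  wseries w e * wseries w' e' =
  wseries (fun p : I * J => w p.1 * w' p.2) (fun p => e p.1 + e' p.2)%N.
Proof.
move=> fe fe'; apply/fpsP => N.
have [s us sE] := wseries_cover N fe; have [t ut tE] := wseries_cover N fe'.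
rewrite fcoefM (@wseries_coef _ _ _ [seq (x, y) | x <- s, y <- t] N); first last.
- by [].
- move=> [x y] /= xy; apply/allpairsP; exists (x, y).
  by split; [apply: sE | apply: tE |]; rewrite //=; lia.
- by rewrite allpairs_uniq // => -[? ?] [? ?] _ _ [-> ->].
rewrite [RHS]big_mkcond [RHS]big_allpairs_dep.
transitivity (\sum_(i < N.+1) \sum_(x <- s) \sum_(y <- t)
    (if e x == i then w x else 0) * (if (e' y == N - i)%N then w' y else 0)).
  apply: eq_bigr => i _; have iN : (i <= N)%N by rewrite -ltnS ltn_ord.
  rewrite (wseries_coef w us sE iN).
  rewrite (wseries_coef w' ut tE (leq_subr i N)).
  rewrite (big_mkcond (fun k => e k == i)) (big_mkcond (fun k => e' k == _)).
  by rewrite big_distrlr.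
rewrite exchange_big; apply: eq_bigr => x _.
rewrite exchange_big; apply: eq_bigr => y _ /=.
have [xN|Nx] := leqP (e x) N; last first.
  rewrite big1 => [|i _]; first by case: eqP => //; lia.
  by case: eqP => [|_]; [have := ltn_ord i; lia | rewrite mul0r].
rewrite (bigD1 (Ordinal (xN : e x < N.+1)%N)) //= eqxx big1 ?addr0; last first.
  move=> i /eqP ne; case: eqP => [xi|]; last by rewrite mul0r.
  by case: ne; apply: val_inj.
have -> : (e' y == N - e x)%N = (e x + e' y == N)%N by apply/eqP/eqP; lia.
by case: eqP; rewrite ?mulr0.
Qed.

Lemma wseries_reindex (I J : choiceType) (h : J -> I) (w : I -> int) (e : I -> nat) :
  bijective h -> wseries w e = wseries (w \o h) (e \o h).
Proof.
case=> g hK gK; apply/fpsP => N /=; apply: reindex_fsbig; split.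
- by move=> j.
- by move=> i j _ _ /(can_inj hK).
- by move=> i /= ei; exists (g i); rewrite /= gK.
Qed.

Lemma wseries_split (I J1 J2 : choiceType) (h1 : J1 -> I) (h2 : J2 -> I)
    (w : I -> int) (e : I -> nat) :
  finite_fibers e -> injective h1 -> injective h2 ->
  (forall x y, h1 x <> h2 y) -> (forall i, (exists x, i = h1 x) \/ (exists y, i = h2 y)) ->
  wseries w e = wseries (w \o h1) (e \o h1) + wseries (w \o h2) (e \o h2).
Proof.
move=> fe inj1 inj2 dis cov; apply/fpsP => N.
pose A1 := [set x | e (h1 x) = N]%classic; pose A2 := [set y | e (h2 y) = N]%classic.
have E1 : \sum_(k \in A1) w (h1 k) = \sum_(k \in (h1 @` A1)%classic) w k.
  by rewrite fsbig_image // => x y _ _; apply: inj1.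
have E2 : \sum_(k \in A2) w (h2 k) = \sum_(k \in (h2 @` A2)%classic) w k.
  by rewrite fsbig_image // => x y _ _; apply: inj2.
rewrite fcoefD [X in _ = X + _]E1 [X in _ = _ + X]E2 /=.
have f1 : finite_set (h1 @` A1)%classic.
  by apply: sub_finite_set (finite_fiber N fe) => _ [x /= xN <-].
have f2 : finite_set (h2 @` A2)%classic.
  by apply: sub_finite_set (finite_fiber N fe) => _ [x /= xN <-].
rewrite -fsbigU0 //; last first.
  by move=> _ [[x _ <-] [y _ /esym/dis]].
apply: eq_fsbigl; apply/seteqP; split.
  move=> i /= ei; case: (cov i) => -[x ix]; [left | right]; exists x => //;
  by rewrite /A1 /A2 /= -ix.
by move=> i [[x xN <-]|[x xN <-]].
Qed.

Lemma wseriesD (I : choiceType) (w w' : I -> int) (e : I -> nat) :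
  finite_fibers e ->
  wseries (fun k => w k + w' k) e = wseries w e + wseries w' e.
Proof.
by move=> fe; apply/fpsP => N /=; apply: fsbig_split; apply: finite_fiber.
Qed.

Lemma wseriesZ (I : choiceType) (c : int) (w : I -> int) (e : I -> nat) :
  finite_fibers e -> wseries (fun k => c * w k) e = c%:~R * wseries w e.
Proof.
move=> fe.
have nat_case n : wseries (fun k => n%:R * w k) e = n%:R * wseries w e.
  elim: n => [|n IHn].
    by apply/fpsP => N; rewrite mul0r /= fsbig1 // => i _; rewrite mul0r.
  rewrite [in RHS]mulrS mulrDl mul1r -IHn -wseriesD //.
  by congr wseries; apply: funext => k; rewrite mulrS mulrDl mul1r.
have pos n : wseries (fun k => n%:Z * w k) e = (n%:Z)%:~R * wseries w e.
  by rewrite -[RHS]nat_case; congr wseries; apply: funext => k; rewrite natz.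
case: c => n; first exact: pos.
rewrite NegzE mulrNz mulNr -pos; apply/eqP; rewrite -subr_eq0 opprK.
rewrite -wseriesD //; apply/eqP/fpsP => N /=; apply: fsbig1 => k _.
by rewrite mulNr addNr.
Qed.

Lemma wseries_shift (I : choiceType) (w : I -> int) (e : I -> nat) :
  wseries w (fun k => (e k).+1) = 'q * wseries w e.
Proof.
apply/fpsP => N; rewrite -['q]expr1 fcoefXnM; case: N => [|N] /=.
  by apply: fsbig1 => k.
by rewrite subn1; apply: eq_fsbigl; apply/seteqP; split => k /= => [[->]|->].
Qed.

Lemma wseries_nat (a : nat -> int) (e : nat -> nat) :
  (forall n, (n <= e n)%N) -> 
  fps_sum 0 (fun n => (a n)%:~R * 'q ^+ e n) = wseries a e.
Proof.
move=> en; have sF : summable (fun n => (a n)%:~R * 'q ^+ e n).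
  by move=> n; apply: eqm0Mr; apply: eqm_leq (en n) _; apply: eqm0X.
apply: fps_sumP => // N m mN.
rewrite (@wseries_coef _ _ _ (index_iota 0 N) m) ?iota_uniq //; last first.
  by move=> k ek; rewrite mem_index_iota; have := en k; lia.
rewrite fcoef_sum [RHS]big_mkcond; apply: eq_bigr => k _.
rewrite mulrC fcoefXnM.
have fz z j : fcoef (z%:~R : {fps int}) j = if j == 0%N then z else 0.
  have fn i : fcoef (i%:R : {fps int}) j = if j == 0%N then i%:R else 0.
    elim: i => [|i IHi]; first by rewrite if_same.
    by rewrite -natr1 fcoefD IHi fcoef1 -natr1; case: eqP; rewrite ?addr0.
  case: z => i; first by rewrite fn natz.
  by rewrite NegzE mulrNz fcoefN fn natz; case: eqP; rewrite ?oppr0.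
by rewrite fz subn_eq0; case: ltngtP.
Qed.

(** * Theta series over the integers *)

(** Triangular numbers n(n+1)/2 for n in Z; n and -n-1 give the same value,
    and they are matched by the two constructors of the integers. *)
Definition tri (n : int) : nat := 'C((match n with Posz n => n | Negz n => n end).+1, 2).

Lemma triE n : 2 * (tri n)%:Z = n * (n + 1).
Proof.
case: n => n; rewrite /tri; have := mul_bin_left n.+1 1; rewrite bin1 subn1 /=.
  by move=> e; rewrite -[2]/(2%:Z) -PoszM e; lia.
by move=> e; rewrite -[2]/(2%:Z) -PoszM e NegzE; lia.
Qed.

Lemma finite_fibers_int (e : int -> nat) :
  (forall k, (`|k| <= (e k).+1)%N) -> finite_fibers e.
Proof.
move=> ek N.
pose s := [seq Posz i | i <- iota 0 N.+2] ++ [seq Negz i | i <- iota 0 N.+2].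
apply: sub_finite_set (finite_seq s) => k /= kN.
rewrite /s mem_cat; apply/orP.
by have := ek k; case: k kN => i iN ki; [left | right]; apply/mapP; exists i;
  rewrite ?mem_iota //; lia.
Qed.

Lemma finite_fibersM (I J : choiceType) (e : I -> nat) (e' : J -> nat) :
  finite_fibers e -> finite_fibers e' ->
  finite_fibers (fun p : I * J => e p.1 + e' p.2)%N.
Proof.
move=> fe fe' N; apply: sub_finite_set (finite_setX (fe N) (fe' N)) => -[x y] /=.
by move=> xy; split => /=; lia.
Qed.

Lemma finite_fibers_comp (I J : choiceType) (e : I -> nat) (h : J -> I) :
  injective h -> finite_fibers e -> finite_fibers (e \o h).
Proof.
move=> inj fe N; apply: (@finite_preimage _ _ [set k | (e k <= N)%N]%classic h) => //.
by move=> x y _ _; apply: inj.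
Qed.


Definition sqn (d : int) : nat := (`|d| * `|d|)%N.

Lemma sqnE d : (sqn d)%:Z = d * d.
Proof. by rewrite /sqn; case: d => n; rewrite ?NegzE /=; lia. Qed.

Definition zsign (n : int) : int := (-1) ^ n.

Lemma zsignD m n : zsign (m + n) = zsign m * zsign n.
Proof. by rewrite /zsign exprzDr ?unitrN1. Qed.

Lemma zsign_double n : zsign (2 * n) = 1.
Proof. by rewrite /zsign -exprz_exp -exprnP sqrrN expr1n exp1rz. Qed.

Lemma zsignN n : zsign (- n) = zsign n.
Proof. by rewrite /zsign -exprz_inv invrN1. Qed.

(** Theta series over Z.  The first two run twice through the series
    sum_(n >= 0) q^(m n(n+1)/2) and sum_(n >= 0) (-1)^n (2n+1) q^(m n(n+1)/2). *)
Definition tri_series (m : nat) : {fps int} :=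
  wseries (fun=> 1) (fun n : int => m * tri n)%N.
Definition cube_series (m : nat) : {fps int} :=
  wseries (fun n : int => zsign n * (2 * n + 1)) (fun n => m * tri n)%N.
Definition square_series (m : nat) : {fps int} :=
  wseries zsign (fun n : int => m * sqn n)%N.

Lemma finite_fibers_tri m : (0 < m)%N -> finite_fibers (fun n : int => m * tri n)%N.
Proof.
move=> m0; apply: finite_fibers_int => n.
have : (tri n <= m * tri n)%N by rewrite leq_pmull.
have := triE n; move: (tri n) (m * tri n)%N => t u tE tu.
have : (`|n| <= t.+1)%N by case: n tE => n; rewrite ?NegzE; nia.
by lia.
Qed.

Lemma finite_fibers_sqn m : (0 < m)%N -> finite_fibers (fun n : int => m * sqn n)%N.
Proof.
move=> m0; apply: finite_fibers_int => n.
have : (sqn n <= m * sqn n)%N by rewrite leq_pmull.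
by rewrite /sqn; nia.
Qed.

Lemma eq_wseries (I : choiceType) (w w' : I -> int) (e e' : I -> nat) :
  w =1 w' -> e =1 e' -> wseries w e = wseries w' e'.
Proof. by move=> /funext -> /funext ->. Qed.

(** With a = 2n+1 and b = 2m+1 the left-hand side is a sum over pairs of odd
    integers with exponent (a^2 + 3b^2 - 4)/8.  Replacing b by -b if necessary,
    a - b is divisible by 4; then v = (a-b)/4 and u = b + v satisfy
    a = u + 3v and a^2 + 3b^2 = 4(u^2 + 3v^2), with u - v odd.  The exponent
    is even or odd with v, and in both classes it is a form without
    cross term. *)
Lemma theta_dissection :
  cube_series 1 * tri_series 3 =
  2%:~R * (cube_series 4 * square_series 6)
    - 6%:~R * ('q * (cube_series 12 * square_series 2)).
Proof.
pose w (p : int * int) : int := zsign p.1 * (2 * p.1 + 1).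
pose e (p : int * int) : nat := (tri p.1 + 3 * tri p.2)%N.
(* h1 and h2 reach the m with a - b, respectively a + b, divisible by 4. *)
pose h1 (p : int * int) : int * int := (p.1, p.1 - 2 * p.2).
pose h2 (p : int * int) : int * int := (p.1, 2 * p.2 - p.1 - 1).
(* g1 and g2 are the cases v even and v odd; the shift of n by 3v/2, rounded
   down, removes the cross term of the exponent. *)
pose g1 (p : int * int) : int * int := (p.1 + 3 * p.2, 2 * p.2).
pose g2 (p : int * int) : int * int := (p.2 + 3 * p.1 + 1, 2 * p.1 + 1).
have ft m : finite_fibers (fun n : int => m.+1 * tri n)%N by apply: finite_fibers_tri.
have fs m : finite_fibers (fun n : int => m.+1 * sqn n)%N by apply: finite_fibers_sqn.
have fe : finite_fibers e.
  have -> : e = (fun p => 1 * tri p.1 + 3 * tri p.2)%N.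
    by apply: funext => p; rewrite mul1n.
  exact: (finite_fibersM (ft 0%N) (ft 2%N)).
have inj1 : injective h1 by move=> [a b] [c d] [-> ?]; congr pair; lia.
have inj2 : injective h2 by move=> [a b] [c d] [-> ?]; congr pair; lia.
have injg1 : injective g1 by move=> [a b] [c d] [? ?]; congr pair; lia.
have injg2 : injective g2 by move=> [a b] [c d] [? ?]; congr pair; lia.
have -> : cube_series 1 * tri_series 3 = wseries w e.
  rewrite /cube_series /tri_series (wseriesM _ _ (ft 0%N) (ft 2%N)).
  by apply: eq_wseries => -[a b]; rewrite /w /e /= ?mulr1 ?mul1n.
rewrite (wseries_split w fe inj1 inj2); first last.
- move=> [a b]; have [k [ab|ab]] : exists k, a - b = 2 * k \/ a - b = 2 * k + 1.
    by exists ((a - b) %/ 2)%Z; lia.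
  + by left; exists (a, k); rewrite /h1 /=; congr pair; lia.
  + by right; exists (a, a - k); rewrite /h2 /=; congr pair; lia.
- by move=> [a b] [c d] [-> ?]; lia.
have -> : wseries (w \o h2) (e \o h2) = wseries (w \o h1) (e \o h1).
  apply: eq_wseries => -[a b] //; rewrite /e /=; congr (_ + 3 * _)%N.
  by have := triE (2 * b - a - 1); have := triE (a - 2 * b); lia.
have fh : finite_fibers (e \o h1) by apply: finite_fibers_comp.
rewrite (wseries_split (w \o h1) fh injg1 injg2); first last.
- move=> [a b]; have [k [ab|ab]] : exists k, b = 2 * k \/ b = 2 * k + 1.
    by exists (b %/ 2)%Z; lia.
  + by left; exists (a - 3 * k, k); rewrite /g1 /=; congr pair; lia.
  + by right; exists (k, a - 3 * k - 1); rewrite /g2 /=; congr pair; lia.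
- by move=> [a b] [c d] [? ?]; lia.
have z3 d : zsign (3 * d) = zsign d.
  by have -> : 3 * d = 2 * d + d by [lia]; rewrite zsignD zsign_double mul1r.
(* Changing the sign of the variable of the square series changes the sign
   of these terms, so they add up to 0. *)
have cancel (f : int -> int) (t : int -> nat) m : finite_fibers t ->
    wseries (fun p : int * int => f p.1 * (zsign p.2 * p.2))
            (fun p => t p.1 + m.+1 * sqn p.2)%N = 0.
  move=> ftt; have ff := finite_fibersM ftt (fs m).
  set x := wseries _ _.
  have xN : x = (-1)%:~R * x.
    rewrite -wseriesZ // /x.
    have bij : bijective (fun p : int * int => (p.1, - p.2)).
      by exists (fun p => (p.1, - p.2)) => -[a b] /=; rewrite opprK.
    rewrite (wseries_reindex _ _ bij); apply: eq_wseries => -[a b] /=.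
      by rewrite zsignN; ring.
    by rewrite /sqn abszN.
  apply/fpsP => N; move/fpsP/(_ N): xN; rewrite rmorphN1 mulN1r fcoefN fcoef0.
  by move: (fcoef x N) => z; lia.
have f1 := finite_fibersM (ft 3%N) (fs 5%N).
have f2 := finite_fibersM (ft 11%N) (fs 1%N).
have -> : wseries ((w \o h1) \o g1) ((e \o h1) \o g1) = cube_series 4 * square_series 6.
  rewrite /cube_series /square_series (wseriesM _ _ (ft 3%N) (fs 5%N)).
  transitivity (wseries (fun p : int * int => zsign p.1 * (2 * p.1 + 1) * zsign p.2
     + 6 * (zsign p.1 * (zsign p.2 * p.2))) (fun p => 4 * tri p.1 + 6 * sqn p.2)%N).
    apply: eq_wseries => -[k d]; rewrite /w /e /=.
      by rewrite zsignD z3; ring.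
    have := triE (k + 3 * d); have := triE (k + 3 * d - 2 * (2 * d)).
    by have := triE k; have := sqnE d; lia.
  by rewrite wseriesD // wseriesZ // (cancel zsign _ 5%N (ft 3%N)) mulr0 addr0.
have -> : wseries ((w \o h1) \o g2) ((e \o h1) \o g2) =
    (-3)%:~R * ('q * (cube_series 12 * square_series 2)).
  rewrite /cube_series /square_series (wseriesM _ _ (ft 11%N) (fs 1%N)).
  transitivity (wseries (fun p : int * int => -3 * (zsign p.1 * (2 * p.1 + 1) * zsign p.2)
     + -2 * (zsign p.1 * (zsign p.2 * p.2)))
     (fun p => (12 * tri p.1 + 2 * sqn p.2).+1)%N).
    apply: eq_wseries => -[d k]; rewrite /w /e /=.
      have -> : zsign (k + 3 * d + 1) = - (zsign k * zsign d).
        by rewrite !zsignD z3 /zsign expr1z mulrN1.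
      by ring.
    have := triE (k + 3 * d + 1); have := triE (k + 3 * d + 1 - 2 * (2 * d + 1)).
    by have := triE d; have := sqnE k; lia.
  rewrite wseries_shift wseriesD // !wseriesZ // (cancel zsign _ 1%N (ft 11%N)).
  by rewrite mulr0 addr0 mulrCA.
move: (cube_series 4 * _) ('q * _) => x y.
have -> : (-3)%:~R = - 3%:R :> {fps int} by rewrite mulrNz.
have -> : 6%:~R = 2%:R * 3%:R :> {fps int} by rewrite -natrM.
have -> : 2%:~R = 2%:R :> {fps int} by [].
by ring.
Qed.

(** * Finite forms of two theta identities *)

(** The recurrence passes from the coefficients b of a Laurent polynomial in z
    to those of its multiple by (1 - zy)(1 - y/z), folded by antisymmetry onto
    r >= 0.  The weights 2r+1 amount to taking the derivative at the zero
    z = 1, which is multiplied by (1 - y)^2; the rest is a boundary term. *)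
Lemma jacobi_weights (A : comPzRingType) (y : A) (b X : nat -> A) N :
  X 0%N = (1 + y ^+ 2) * b 0%N - y * (b 1%N - b 0%N) ->
  (forall r, X r.+1 = (1 + y ^+ 2) * b r.+1 - y * (b r.+2 + b r)) ->
  \sum_(0 <= r < N.+1) (2 * r + 1)%:R * X r =
  (1 - y) ^+ 2 * \sum_(0 <= r < N.+1) (2 * r + 1)%:R * b r
  - y * ((2 * N + 1)%:R * b N.+1 - (2 * N + 3)%:R * b N).
Proof.
move=> X0 XS; elim: N => [|N IHN]; first by rewrite !big_nat1 X0 /=; ring.
rewrite big_nat_recr // IHN [X in _ = _ * X - _]big_nat_recr //= XS.
move: (\sum_(_ <= _ < _) _) => S; ring.
Qed.

(** The analogue for symmetric coefficients at z = 1, where the index 0 counts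
    once and every other index twice. *)
Lemma gauss_weights (A : comPzRingType) (y : A) (b X : nat -> A) N :
  X 0%N = (1 + y ^+ 2) * b 0%N - 2%:R * y * b 1%N ->
  (forall r, X r.+1 = (1 + y ^+ 2) * b r.+1 - y * (b r.+2 + b r)) ->
  \sum_(0 <= r < N.+1) (r > 0).+1%:R * X r =
  (1 - y) ^+ 2 * \sum_(0 <= r < N.+1) (r > 0).+1%:R * b r
  - 2%:R * y * (b N.+1 - b N).
Proof.
move=> X0 XS; elim: N => [|N IHN]; first by rewrite !big_nat1 X0 /=; ring.
rewrite big_nat_recr // IHN [X in _ = _ * X - _]big_nat_recr //= XS.
move: (\sum_(_ <= _ < _) _) => S; ring.
Qed.

Lemma coef0_unit1B (R : comUnitRingType) (f : {fps R}) :
  fcoef f 0 = 0 -> 1 - f \is a GRing.unit.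
Proof. by move=> f0; rewrite fps_unitE fcoefB f0 subr0 unitr1. Qed.

(** A finite form of Jacobi's identity for (q;q)_oo^3.  The normalised summand
    b n r satisfies the three-term recurrence of [jacobi_weights] in n, with
    y = q^(n+1). *)
Lemma jacobi_finite (R : comUnitRingType) (q : {fps R}) n : fcoef q 0 = 0 ->
  \sum_(0 <= r < n.+1) (2 * r + 1)%:R * ((-1) ^+ r * q ^+ 'C(r.+1, 2)
     * qfact_inv q n r / qpoch q q (n + r).+1)
  = qpoch q q n ^+ 2 / qpoch q q (2 * n).+1.
Proof.
move=> q0.
pose c r : {fps R} := (-1) ^+ r * q ^+ 'C(r.+1, 2).
have cS r : c r.+1 = - (c r * (q * q ^+ r)).
  by rewrite /c exprS binS bin1 exprD -(exprS q r); ring.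
pose b k r := c r * qfact_inv q k r / qpoch q q (k + r).+1.
have bout k r : (k < r)%N -> b k r = 0.
  by move=> kr; rewrite /b /qfact_inv leqNgt kr /= mulr0 mul0r.
rewrite -/(b n _); elim: n => [|n IHn].
  rewrite big_nat1 /b /c /qfact_inv /= !qpochS !qpoch0 expr0 !mul1r invr1 mulr1.
  by rewrite expr1n mul1r.
pose y := q ^+ n.+1.
pose X r := (1 - y ^+ 2) * (1 - q * y ^+ 2) * b n.+1 r.
have bnr r : (r <= n.+1)%N -> b n r = c r * qfact_inv q n.+1 r * (1 - q ^+ (n.+1 - r))
     * ((qpoch q q (n + r).+2)^-1 * (1 - q * q ^+ r ^+ 2 * q ^+ (n.+1 - r))).
  move=> rn; rewrite /b (qpochV_S (n + r).+1 q0).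
  have -> : qfact_inv q n r = qfact_inv q n.+1 r * (1 - q ^+ (n.+1 - r)).
    by rewrite -qfact_invSr // qfact_invSS.
  have -> : q ^+ (n + r).+2 = q * q ^+ r ^+ 2 * q ^+ (n.+1 - r).
    by rewrite -exprM -exprS -exprD; congr (_ ^+ _); lia.
  by move: (qpoch _ _ _)^-1 (c r) (qfact_inv _ _ _) (q ^+ _) (q ^+ r) => *; ring.
have bnr1 r : (r <= n.+1)%N -> b n r.+1 =
    - (c r * q ^+ r * qfact_inv q n.+1 r * (1 - q ^+ (n.+1 - r)) * (q - q ^+ (n.+1 - r))
     * (qpoch q q (n + r).+2)^-1).
  move=> rn; rewrite /b addnS cS.
  have -> : q - q ^+ (n.+1 - r) = q * (1 - q ^+ (n - r)) + (q ^+ (n - r).+1 - q ^+ (n.+1 - r)).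
    by rewrite exprS; ring.
  case: (ltnP r n.+1) => rn1; last first.
    have -> : (n.+1 - r = 0)%N by lia.
    by rewrite /qfact_inv [(r.+1 <= n)%N]leqNgt ltnS ltnW //= expr0 subrr !(mulr0, mul0r) oppr0.
  have -> : qfact_inv q n r.+1 = qfact_inv q n.+1 r * (1 - q ^+ (n.+1 - r)) * (1 - q ^+ (n - r)).
    by rewrite -(@qfact_invSr _ q n.+1 r) // qfact_invSS qfact_invSr.
  rewrite (subSn (rn1 : (r <= n)%N)) subrr addr0.
  by move: (qpoch _ _ _)^-1 (c r) (qfact_inv _ _ _) (q ^+ r) (q ^+ _) (q ^+ _) => *; ring.
have bSr r : b n.+1 r = c r * qfact_inv q n.+1 r / qpoch q q (n + r).+2.
  by rewrite /b addSn.
have yE r : (r <= n.+1)%N -> y = q ^+ (n.+1 - r) * q ^+ r.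
  by move=> rn; rewrite -exprD subnK.
have X0 : X 0%N = (1 + y ^+ 2) * b n 0%N - y * (b n 1%N - b n 0%N).
  rewrite /X bnr // bnr1 // bSr subn0 addn0 expr0 expr1n -/y.
  by move: (qpoch _ _ _)^-1 (c 0%N) (qfact_inv _ _ _); generalize y => *; ring.
have XS r : X r.+1 = (1 + y ^+ 2) * b n r.+1 - y * (b n r.+2 + b n r).
  case: (leqP r n) => rn; last by rewrite /X !bout ?mulr0 ?addr0 ?mulr0 ?subr0 //; lia.
  rewrite /X bnr // bnr1 // bSr (yE r.+1) // addnS.
  have -> : b n r = c r * qfact_inv q n.+1 r.+1 * ((qpoch q q (n + r).+3)^-1
      * (1 - q * q ^+ r.+1 ^+ 2 * q ^+ (n.+1 - r.+1)) * (1 - q ^+ r.+1 ^+ 2 * q ^+ (n.+1 - r.+1))).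
    rewrite /b (qpochV_S (n + r).+1 q0) (qpochV_S (n + r).+2 q0) qfact_invSS.
    have -> : q ^+ (n + r).+3 = q * q ^+ r.+1 ^+ 2 * q ^+ (n.+1 - r.+1).
      by rewrite -exprM -exprS -exprD; congr (_ ^+ _); lia.
    have -> : q ^+ (n + r).+2 = q ^+ r.+1 ^+ 2 * q ^+ (n.+1 - r.+1).
      by rewrite -exprM -exprD; congr (_ ^+ _); lia.
    by rewrite !mulrA.
  rewrite cS -(exprS q r).
  move: (qpoch _ _ _)^-1 (c r) (qfact_inv _ _ _) (q ^+ (_ - _)) (q ^+ r.+1).
  by move=> p c' i A x; ring.
have := jacobi_weights n.+1 X0 XS.
rewrite !bout // !mulr0 subrr mulr0 subr0.
rewrite [X in _ = _ * X]big_nat_recr //= bout // mulr0 addr0 IHn.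
rewrite (eq_bigr (fun r => (1 - y ^+ 2) * (1 - q * y ^+ 2) * ((2 * r + 1)%:R * b n.+1 r))).
  rewrite -mulr_sumr => e.
  have z0 f : fcoef (y * f) 0 = 0 by rewrite /y exprS -mulrA fcoefM0 q0 mul0r.
  have u : (1 - y ^+ 2) * (1 - q * y ^+ 2) \is a GRing.unit.
    rewrite unitrM !coef0_unit1B //; last by rewrite expr2.
    by rewrite fcoefM0 q0 mul0r.
  apply: (mulrI u); rewrite {}e.
  rewrite (qpochV_S (2 * n).+1 q0) (qpochV_S (2 * n).+2 q0) mulnS (qpochS q q n).
  rewrite -(exprS q n) -/y.
  have -> : q ^+ (2 * n).+2 = y ^+ 2 by rewrite -exprM; congr (_ ^+ _); lia.
  have -> : q ^+ (2 * n).+3 = q * y ^+ 2 by rewrite -exprM -exprS; congr (_ ^+ _); lia.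
  by move: (qpoch _ _ _)^-1 (qpoch _ _ _); generalize y => *; ring.
by move=> r _; rewrite /X; move: (b _ _) => t; ring.
Qed.

(** The finite form of Gauss's identity for sum_Z (-1)^r q^(r^2), by the same
    recurrence with base q^2 and y = q^(2n+1). *)
Lemma gauss_finite (R : comUnitRingType) (q : {fps R}) n : fcoef q 0 = 0 ->
  \sum_(0 <= r < n.+1) (r > 0).+1%:R * ((-1) ^+ r * q ^+ (r * r)
     * qfact_inv (q ^+ 2) n r / qpoch (q ^+ 2) (q ^+ 2) (n + r))
  = qpoch q (q ^+ 2) n ^+ 2 / qpoch (q ^+ 2) (q ^+ 2) (2 * n).
Proof.
move=> q0; have Q0 : fcoef (q ^+ 2) 0 = 0 by rewrite fcoefM0 q0 mul0r.
set Q := q ^+ 2 in Q0 *.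
have QE k : Q ^+ k = q ^+ (2 * k) by rewrite /Q -exprM.
pose c r : {fps R} := (-1) ^+ r * q ^+ (r * r).
have cS r : c r.+1 = - (c r * (q * q ^+ r ^+ 2)).
  rewrite /c exprS -exprM.
  have -> : q ^+ (r.+1 * r.+1) = q ^+ (r * r) * (q * q ^+ (r * 2)).
    by rewrite -exprS -exprD; congr (_ ^+ _); lia.
  by ring.
pose b k r := c r * qfact_inv Q k r / qpoch Q Q (k + r).
have bout k r : (k < r)%N -> b k r = 0.
  by move=> kr; rewrite /b /qfact_inv leqNgt kr /= mulr0 mul0r.
rewrite -/(b n _); elim: n => [|n IHn].
  by rewrite big_nat1 /b /c /qfact_inv /= !qpoch0 expr0 expr1n !mul1r !invr1 !mulr1.
pose y := q ^+ (2 * n).+1.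
pose L := (1 - y ^+ 2) * (1 - q ^+ 2 * y ^+ 2).
pose X r := L * b n.+1 r.
have bnr r : (r <= n)%N -> b n r =
    c r * qfact_inv Q n.+1 r * (1 - q ^+ 2 * Q ^+ (n - r))
     * ((qpoch Q Q (n + r).+1)^-1 * (1 - q ^+ 2 * q ^+ r ^+ 4 * Q ^+ (n - r))).
  move=> rn; rewrite /b (qpochV_S (n + r) Q0).
  have -> : qfact_inv Q n r = qfact_inv Q n.+1 r * (1 - Q ^+ (n.+1 - r)).
    by rewrite -qfact_invSr ?qfact_invSS // leqW.
  have -> : Q ^+ (n + r).+1 = q ^+ 2 * q ^+ r ^+ 4 * Q ^+ (n - r).
    by rewrite !QE -exprM -!exprD; congr (_ ^+ _); lia.
  rewrite (subSn rn) (exprS Q (n - r)) -/Q.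
  by move: (qpoch _ _ _)^-1 (c r) (qfact_inv _ _ _) (Q ^+ _) (q ^+ r); generalize Q => *; ring.
have bnr1 r : (r <= n)%N -> b n r.+1 =
    - (c r * (q * q ^+ r ^+ 2) * qfact_inv Q n.+1 r * (1 - q ^+ 2 * Q ^+ (n - r))
     * (1 - Q ^+ (n - r)) * (qpoch Q Q (n + r).+1)^-1).
  move=> rn; rewrite /b addnS cS.
  have -> : qfact_inv Q n r.+1 = qfact_inv Q n.+1 r * (1 - Q ^+ (n.+1 - r)) * (1 - Q ^+ (n - r)).
    by rewrite -(@qfact_invSr _ Q n.+1 r) ?qfact_invSS ?qfact_invSr // leqW.
  rewrite (subSn rn) (exprS Q (n - r)) -/Q.
  by move: (qpoch _ _ _)^-1 (c r) (qfact_inv _ _ _) (Q ^+ _) (q ^+ r); generalize Q => *; ring.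
have bSr r : b n.+1 r = c r * qfact_inv Q n.+1 r / qpoch Q Q (n + r).+1.
  by rewrite /b addSn.
have yE r : (r <= n)%N -> y = q * Q ^+ (n - r) * q ^+ r ^+ 2.
  by move=> rn; rewrite QE -exprM -exprS -exprD; congr (_ ^+ _); lia.
have X0 : X 0%N = (1 + y ^+ 2) * b n 0%N - 2%:R * y * b n 1%N.
  rewrite /X /L bnr // bnr1 // bSr (yE 0%N) // subn0 addn0 expr0.
  by move: (qpoch _ _ _)^-1 (c 0%N) (qfact_inv _ _ _) (Q ^+ n) => *; ring.
have XS r : X r.+1 = (1 + y ^+ 2) * b n r.+1 - y * (b n r.+2 + b n r).
  case: (ltngtP r n) => rn.
  - rewrite /X /L bnr // bnr1 // bSr (yE r.+1) // addnS.
    have -> : b n r = c r * qfact_inv Q n.+1 r.+1 * ((qpoch Q Q (n + r).+2)^-1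
        * (1 - q ^+ 2 * q ^+ r.+1 ^+ 4 * Q ^+ (n - r.+1))
        * (1 - q ^+ r.+1 ^+ 4 * Q ^+ (n - r.+1))).
      rewrite /b (qpochV_S (n + r) Q0) (qpochV_S (n + r).+1 Q0) qfact_invSS.
      have -> : Q ^+ (n + r).+2 = q ^+ 2 * q ^+ r.+1 ^+ 4 * Q ^+ (n - r.+1).
        by rewrite !QE -exprM -!exprD; congr (_ ^+ _); lia.
      have -> : Q ^+ (n + r).+1 = q ^+ r.+1 ^+ 4 * Q ^+ (n - r.+1).
        by rewrite !QE -exprM -!exprD; congr (_ ^+ _); lia.
      by rewrite !mulrA.
    rewrite cS (exprS q r).
    move: (qpoch _ _ _)^-1 (c r) (qfact_inv _ _ _) (Q ^+ (_ - _)) (q ^+ r).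
    by move=> p c' i B t; ring.
  - by rewrite /X !bout ?mulr0 ?addr0 ?mulr0 ?subr0 //; lia.
  rewrite rn /X (bout n n.+1) ?(bout n n.+2) // mulr0 sub0r add0r bSr cS /b /qfact_inv !leqnn !subnn !qpoch0 addnS.
  rewrite (qpochV_S (n + n) Q0) (qpochV_S (n + n).+1 Q0) /L.
  have -> : Q ^+ (n + n).+1 = y ^+ 2 by rewrite QE -exprM; congr (_ ^+ _); lia.
  have -> : Q ^+ (n + n).+2 = q ^+ 2 * y ^+ 2.
    by rewrite QE -exprM -exprD; congr (_ ^+ _); lia.
  have -> : q * q ^+ n ^+ 2 = y by rewrite -exprM -exprS; congr (_ ^+ _); lia.
  by move: (qpoch _ _ _)^-1 (c n); generalize y => *; rewrite invr1; ring.
have := gauss_weights n.+1 X0 XS.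
rewrite !bout // subrr mulr0 subr0.
rewrite [X in _ = _ * X]big_nat_recr //= bout // mulr0 addr0 IHn.
rewrite (eq_bigr (fun r => L * ((r > 0).+1%:R * b n.+1 r))).
  rewrite -mulr_sumr => e.
  have z0 f : fcoef (y * f) 0 = 0 by rewrite /y exprS -mulrA fcoefM0 q0 mul0r.
  have u : L \is a GRing.unit.
    rewrite unitrM !coef0_unit1B //; last by rewrite expr2.
    by rewrite fcoefM0 Q0 mul0r.
  apply: (mulrI u); rewrite {}e.
  rewrite (qpochV_S (2 * n) Q0) (qpochV_S (2 * n).+1 Q0) mulnS (qpochS q Q n).
  have -> : q * Q ^+ n = y by rewrite QE -exprS.
  have -> : Q ^+ (2 * n).+1 = y ^+ 2 by rewrite QE -exprM; congr (_ ^+ _); lia.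
  have -> : Q ^+ (2 * n).+2 = q ^+ 2 * y ^+ 2.
    by rewrite QE -exprM -exprD; congr (_ ^+ _); lia.
  rewrite /L; move: (qpoch Q _ _)^-1 (qpoch q _ _); generalize y => *; ring.
by move=> r _; rewrite /X; move: (b _ _) => t; generalize L => *; ring.
Qed.

(** * The theta identities in the limit *)

(** Modulo q^N only the terms r < N matter; for n = 2N and such r both n - r and
    n + r exceed N, and the finite products become infinite ones. *)
Lemma bailey_limit (R : comUnitRingType) (Q : {fps R}) (c V : nat -> {fps R}) d W :
  fcoef Q 0 = 0 -> (forall r, eqm r (c r) 0) ->
  (forall n, \sum_(0 <= r < n.+1) c r * (qfact_inv Q n r / qpoch Q Q (n + r + d)) = V n) ->
  (forall N, eqm N (V (2 * N)%N) W) ->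
  fps_sum 0 c = W * qpoch_inf Q Q ^+ 2.
Proof.
move=> Q0 c0 cV VW; set P := qpoch_inf Q Q.
have uP : P \is a GRing.unit by apply: qpoch_inf_unit.
suff -> : W = fps_sum 0 c * (P^-1 * P^-1).
  move: (fps_sum 0 c) => S; transitivity (S * (P / P) * (P / P)); last by ring.
  by rewrite mulrV // !mulr1.
apply/esym/eqmP => N; apply: eqm_trans (VW N); rewrite -cV.
apply: (@eqm_trans _ _ ((\sum_(0 <= r < (2 * N).+1) c r) * (P^-1 * P^-1))).
  by apply: eqmM => //; apply: fps_sum_eqm => //; lia.
rewrite mulr_suml; apply: eqm_sum => r _.
have [rN|Nr] := ltnP r N; last first.
  have z f : eqm N (c r * f) 0 by apply: (@eqm_leq _ _ r) => //; apply: eqm0Ml.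
  by apply: (@eqm_trans _ _ 0) => //; apply: eqm_sym.
apply: eqmM => //; rewrite /qfact_inv ifT; last by lia.
by apply: eqmM; apply: eqmV; rewrite ?qpoch_unit //; apply: qpoch_inf_eqm => //; lia.
Qed.

Theorem jacobi_cube (R : comUnitRingType) (q : {fps R}) : fcoef q 0 = 0 ->
  fps_sum 0 (fun r => (2 * r + 1)%:R * ((-1) ^+ r * q ^+ 'C(r.+1, 2))) =
  qpoch_inf q q ^+ 3.
Proof.
move=> q0; have uP : qpoch_inf q q \is a GRing.unit by apply: qpoch_inf_unit.
rewrite (@bailey_limit _ q _ (fun n => qpoch q q n ^+ 2 / qpoch q q (2 * n).+1) 1
  (qpoch_inf q q ^+ 2 / qpoch_inf q q)) //.
- by rewrite expr2 mulrK // -exprS.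
- move=> r; do 2 apply: eqm0Mr; apply: (@eqm_leq _ _ 'C(r.+1, 2)); last exact: eqm0X.
  by rewrite binS bin1 leq_addl.
- move=> n; rewrite -jacobi_finite //; apply: eq_bigr => r _; rewrite (addn1 (n + r)).
  by rewrite -!mulrA.
move=> N; rewrite !expr2; apply: eqmM.
  by apply: eqmM; apply: eqm_sym; apply: qpoch_inf_eqm => //; lia.
by apply: eqmV; rewrite ?qpoch_unit //; apply: eqm_sym; apply: qpoch_inf_eqm => //; lia.
Qed.

Theorem gauss_square (R : comUnitRingType) (q : {fps R}) : fcoef q 0 = 0 ->
  fps_sum 0 (fun r => (r > 0).+1%:R * ((-1) ^+ r * q ^+ (r * r))) =
  qpoch_inf q (q ^+ 2) ^+ 2 * qpoch_inf (q ^+ 2) (q ^+ 2).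
Proof.
move=> q0; have Q0 : fcoef (q ^+ 2) 0 = 0 by rewrite fcoefM0 q0 mul0r.
have uP : qpoch_inf (q ^+ 2) (q ^+ 2) \is a GRing.unit by apply: qpoch_inf_unit.
rewrite (@bailey_limit _ (q ^+ 2) _
  (fun n => qpoch q (q ^+ 2) n ^+ 2 / qpoch (q ^+ 2) (q ^+ 2) (2 * n)) 0
  (qpoch_inf q (q ^+ 2) ^+ 2 / qpoch_inf (q ^+ 2) (q ^+ 2))) //.
- move: (qpoch_inf (q ^+ 2) _) (qpoch_inf q _) uP => P A uP.
  by rewrite expr2 (expr2 P) -mulrA mulKr.
- move=> r; do 2 apply: eqm0Mr; apply: (@eqm_leq _ _ (r * r)%N); last exact: eqm0X.
  by case: r => // r; rewrite leq_pmull.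
- move=> n; rewrite -gauss_finite //; apply: eq_bigr => r _; rewrite (addn0 (n + r)).
  by rewrite -!mulrA.
move=> N; rewrite !expr2; apply: eqmM.
  by apply: eqmM; apply: eqm_sym; apply: qpoch_inf_eqm => //; lia.
by apply: eqmV; rewrite ?qpoch_unit //; apply: eqm_sym; apply: qpoch_inf_eqm => //; lia.
Qed.

(** * The lattice theta series as eta quotients *)

Lemma coefq0 m : (0 < m)%N -> fcoef ('q ^+ m) 0 = 0.
Proof. by case: m => // m _; apply: coef0X. Qed.

Lemma int_split (w : int -> int) (e : int -> nat) : finite_fibers e ->
  wseries w e = wseries (w \o Posz) (e \o Posz) + wseries (w \o Negz) (e \o Negz).
Proof.
move=> fe; apply: wseries_split => //; try by move=> x y [].
by case=> n; [left | right]; exists n.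
Qed.

Lemma zsign_Negz n : zsign (Negz n) = (-1) ^+ n.+1.
Proof. by rewrite NegzE zsignN. Qed.

Lemma intr_sign (R : pzRingType) n : ((-1) ^+ n : int)%:~R = (-1) ^+ n :> R.
Proof. by rewrite rmorphXn rmorphN1. Qed.

Lemma cube_seriesE m : (0 < m)%N -> cube_series m = 2%:R * J m ^+ 3.
Proof.
move=> m0; have q0 := coefq0 m0.
rewrite /cube_series int_split; last exact: finite_fibers_tri.
set x := wseries _ _; set y := wseries _ _.
have em n : (n <= m * tri (Posz n))%N.
  by rewrite /tri binS bin1 (leq_trans (leq_addl _ _) (leq_pmull _ m0)).
have <- : x = y.
  apply: eq_wseries => n //=.
  by rewrite zsign_Negz exprS /zsign -exprnP NegzE; ring.
suff -> : x = J m ^+ 3 by rewrite mulr2n mulrDl mul1r.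
rewrite /x -wseries_nat // /J -jacobi_cube //; apply: eq_fps_sum => n /=.
rewrite -exprM; move: ('q ^+ _) => z.
rewrite /zsign -exprnP intrM intr_sign rmorphD rmorphM /=.
have -> : (2 * n + 1)%:R = 2%:~R * (Posz n)%:~R + 1%:~R :> {fps int}.
  by rewrite natrD natrM.
by ring.
Qed.

Lemma tri_seriesE m : (0 < m)%N ->
  tri_series m = 2%:R * fps_sum 0 (fun n => 'q ^+ (m * 'C(n.+1, 2))).
Proof.
move=> m0; rewrite /tri_series int_split; last exact: finite_fibers_tri.
set x := wseries _ _.
have em n : (n <= m * tri (Posz n))%N.
  by rewrite /tri binS bin1 (leq_trans (leq_addl _ _) (leq_pmull _ m0)).
rewrite /x -wseries_nat // mulr2n mulrDl mul1r.
by congr (_ + _); apply: eq_fps_sum => n /=; rewrite mul1r.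
Qed.

Lemma J_dissect m : (0 < m)%N ->
  J m = qpoch_inf ('q ^+ m) ('q ^+ (2 * m)) * J (2 * m).
Proof.
move=> m0; have q0 := coefq0 m0.
by rewrite {1}/J (qpoch_inf_dissect2 q0 q0) -exprM -exprD mulnC /J mul2n -addnn.
Qed.

Lemma square_seriesE m : (0 < m)%N ->
  square_series m * J (2 * m) = J m ^+ 2.
Proof.
move=> m0; have q0 := coefq0 m0.
have q20 : fcoef ('q ^+ m ^+ 2) 0 = 0 by rewrite fcoefM0 q0 mul0r.
suff -> : square_series m = qpoch_inf ('q ^+ m) ('q ^+ (2 * m)) ^+ 2 * J (2 * m).
  rewrite (J_dissect m0); move: (qpoch_inf _ _) (J _) => a b; ring.
have -> : J (2 * m) = qpoch_inf ('q ^+ m ^+ 2) ('q ^+ m ^+ 2) by rewrite -exprM mulnC.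
have -> : 'q ^+ (2 * m) = 'q ^+ m ^+ 2 :> {fps int} by rewrite -exprM mulnC.
rewrite -gauss_square // /square_series int_split; last exact: finite_fibers_sqn.
pose c r : {fps int} := (r > 0).+1%:R * ((-1) ^+ r * 'q ^+ m ^+ (r * r)).
pose d r : {fps int} := (-1) ^+ r * 'q ^+ m ^+ (r * r).
have rr r : (r <= r * r)%N by case: r => // r; rewrite leq_pmull.
have mrr r : (r <= m * (r * r))%N by rewrite (leq_trans (rr r)) // leq_pmull.
have sd : summable d.
  by move=> r; apply: eqm0Mr; apply: (@eqm_leq _ _ (r * r)%N) => //; apply: eqm0X.
have sd1 : summable (fun n => d n.+1).
  by move=> n; apply: eqm_leq (sd n.+1).
have sc : summable c by move=> r; apply: eqm0Mr; apply: sd.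
have -> : wseries (zsign \o Posz) ((fun n : int => m * sqn n)%N \o Posz) = fps_sum 0 d.
  rewrite -wseries_nat //; apply: eq_fps_sum => n /=.
  by rewrite /zsign -exprnP intr_sign /sqn /= /d -exprM.
have -> : wseries (zsign \o Negz) ((fun n : int => m * sqn n)%N \o Negz)
    = fps_sum 0 (fun n => d n.+1).
  rewrite -wseries_nat; last first.
    by move=> n /=; rewrite /sqn /= (leq_trans (leqnSn n)).
  by apply: eq_fps_sum => n /=; rewrite zsign_Negz intr_sign /sqn /= /d -exprM.
rewrite (fps_sum_recl sd) -/(c _) (fps_sum_recl sc) -addrA; congr (_ + _).
  by rewrite /c mul1r.
by rewrite -fps_sumD //; apply: eq_fps_sum => n; rewrite /c /d /= mulr2n mulrDl mul1r.
Qed.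

Lemma J_unitS m : J m.+1 \is a GRing.unit.
Proof. exact: J_unit. Qed.


(** [theta_dissection] with the theta series replaced by their products: each
    series over Z that runs through its terms twice contributes a factor 2,
    and 4 is cancelled at the end. *)
Lemma cube_dissection :
  J 1 ^+ 3 * fps_sum 0 (fun n => 'q ^+ (3 * 'C(n.+1, 2))) =
  J 4 ^+ 3 * (J 6 ^+ 2 / J 12) - 3%:R * 'q * (J 12 ^+ 3 * (J 2 ^+ 2 / J 4)).
Proof.
have four (f g : {fps int}) : 4%:R * f = 4%:R * g -> f = g.
  move=> fg; apply/fpsP => n; move/fpsP/(_ n): fg.
  rewrite !mulr_natl !(mulrS, mulr0n) !fcoefD !fcoef0.
  by move: (fcoef f n) (fcoef g n) => a b; lia.
have alg (a1 a2 a4 a6 a12 s2 s6 t q c1 c4 c12 u : {fps int}) :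
    a4 \is a GRing.unit -> a12 \is a GRing.unit ->
    s6 * a12 = a6 ^+ 2 -> s2 * a4 = a2 ^+ 2 ->
    c1 = 2%:R * a1 ^+ 3 -> c4 = 2%:R * a4 ^+ 3 -> c12 = 2%:R * a12 ^+ 3 ->
    u = 2%:R * t ->
    c1 * u = 2%:~R * (c4 * s6) - 6%:~R * (q * (c12 * s2)) ->
    a1 ^+ 3 * t = a4 ^+ 3 * (a6 ^+ 2 / a12) - 3%:R * q * (a12 ^+ 3 * (a2 ^+ 2 / a4)).
  move=> u4 u12 <- <- -> -> -> -> e; rewrite !mulrK //; apply: four.
  transitivity (2%:R * a1 ^+ 3 * (2%:R * t)); first by ring.
  by rewrite e; ring.
by apply: (alg _ _ _ _ _ _ _ _ _ _ _ _ _ (J_unitS 3) (J_unitS 11)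
  (@square_seriesE 6 isT) (@square_seriesE 2 isT) (@cube_seriesE 1 isT)
  (@cube_seriesE 4 isT) (@cube_seriesE 12 isT) (@tri_seriesE 3 isT) theta_dissection).
Qed.

(** * The alternating sum as an eta quotient *)

(** This quotient and the next are the E and D with A - O = E(q^2) - 3 q D(q^2). *)
Definition even_quotient : {fps int} := J 2 ^+ 3 * J 3 ^+ 2 / (J 1 ^+ 3 * J 6).
Definition odd_quotient : {fps int} := J 6 ^+ 3 / (J 1 * J 2).

Lemma fps_sq_J m : fps_sq (J m.+1) = J (2 * m.+1).
Proof.
have q0 := @coefq0 m.+1 isT.
have sqX (x y : {fps int}) n : fps_sq x = y -> fps_sq (x ^+ n) = y ^+ n.
  by move=> <-; apply: rmorphXn.
have e : fps_sq ('q ^+ m.+1) = 'q ^+ (2 * m.+1) :> {fps int}.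
  by rewrite (sqX _ _ m.+1 (fps_sqX _)) -exprM.
by rewrite /J (fps_sq_qpoch_inf q0 q0) e.
Qed.

(** The product in front of the theta series is J_1^3/J_2^3, as
    (q;q)_oo = J_1, (-q;q)_oo = J_2/J_1 and (q;q^2)_oo = J_1/J_2. *)
Lemma alternating_dissection :
  fps_sum 0 (fun k => (-1) ^+ k * bterm 'q k) =
  fps_sq even_quotient - 3%:R * 'q * fps_sq odd_quotient.
Proof.
have alg (a1 a2 a4 a6 a12 b c t q x y P : {fps int}) :
    a1 \is a GRing.unit -> a2 \is a GRing.unit -> a4 \is a GRing.unit ->
    a12 \is a GRing.unit -> b \is a GRing.unit ->
    a1 * b = a2 -> a1 = c * a2 ->
    x = a4 ^+ 3 * a6 ^+ 2 / (a2 ^+ 3 * a12) -> y = a12 ^+ 3 / (a2 * a4) ->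
    a1 ^+ 3 * t = a4 ^+ 3 * (a6 ^+ 2 / a12) - 3%:R * q * (a12 ^+ 3 * (a2 ^+ 2 / a4)) ->
    P = a1 / b * (c / a2 * t) -> P = x - 3%:R * q * y.
  move=> u1 u2 u4 u12 ub ab ac -> -> e ->.
  have u23 : a2 ^+ 3 \is a GRing.unit by rewrite unitrX.
  apply: (mulIr u23).
  transitivity (a1 ^+ 3 * t).
    transitivity (a1 * (c * a2) * (a2 / b) * t * (a2 / a2)); first by ring.
    rewrite -ac mulrV // -[in a2 / b]ab mulrK //.
    by ring.
  rewrite e (invrM u23 u12) (invrM u2 u4).
  transitivity (a4 ^+ 3 * (a6 ^+ 2 / a12) * (a2 ^+ 3 / a2 ^+ 3)
     - 3%:R * q * (a12 ^+ 3 * (a2 ^+ 2 / a4)) * (a2 / a2)); last by ring.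
  by rewrite !mulrV // !mulr1.
have sqE : fps_sq even_quotient = J 4 ^+ 3 * J 6 ^+ 2 / (J 2 ^+ 3 * J 12).
  have sqM (a b c d a' b' c' d' : {fps int}) :
      c \is a GRing.unit -> d \is a GRing.unit -> fps_sq a = a' -> fps_sq b = b' ->
      fps_sq c = c' -> fps_sq d = d' ->
      fps_sq (a ^+ 3 * b ^+ 2 / (c ^+ 3 * d)) = a' ^+ 3 * b' ^+ 2 / (c' ^+ 3 * d').
    move=> uc ud <- <- <- <-.
    rewrite !(rmorphM, rmorphXn) rmorphV ?unitrM ?unitrX ?uc //.
    by rewrite !(rmorphM, rmorphXn).
  exact: (sqM _ _ _ _ _ _ _ _ (J_unitS 0) (J_unitS 5) (fps_sq_J 1) (fps_sq_J 2)
    (fps_sq_J 0) (fps_sq_J 5)).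
have sqO : fps_sq odd_quotient = J 12 ^+ 3 / (J 2 * J 4).
  have sqM (a b c a' b' c' : {fps int}) :
      b \is a GRing.unit -> c \is a GRing.unit -> fps_sq a = a' -> fps_sq b = b' ->
      fps_sq c = c' -> fps_sq (a ^+ 3 / (b * c)) = a' ^+ 3 / (b' * c').
    move=> ub uc <- <- <-; rewrite !(rmorphM, rmorphXn) rmorphV ?unitrM ?ub //.
    by rewrite rmorphM.
  exact: (sqM _ _ _ _ _ _ (J_unitS 0) (J_unitS 1) (fps_sq_J 5) (fps_sq_J 0)
    (fps_sq_J 1)).
have Nq0 : fcoef (- 'q) 0 = 0 by apply: coef0N.
apply: (alg _ _ _ _ _ (qpoch_inf (- 'q) 'q) _ _ _ _ _ _ (J_unitS 0) (J_unitS 1)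
  (J_unitS 3) (J_unitS 11) _ _ (@J_dissect 1 isT) sqE sqO cube_dissection).
- exact: qpoch_inf_unit.
- exact: qpoch_infNM.
by rewrite bterm_alternating // alternating_theta.
Qed.

(** * Parity *)

Definition even_coefs (f : {fps int}) := forall n, (2 %| fcoef f n)%Z.

Lemma even_coefsD f g : even_coefs f -> even_coefs g -> even_coefs (f + g).
Proof. by move=> ef eg n; rewrite fcoefD rpredD. Qed.

Lemma even_coefsMl f g : even_coefs f -> even_coefs (f * g).
Proof.
by move=> ef n; rewrite fcoefM; apply: rpred_sum => i _; apply: dvdz_mulr; apply: ef.
Qed.

Lemma even_coefsMr f g : even_coefs g -> even_coefs (f * g).
Proof. by rewrite mulrC; apply: even_coefsMl. Qed.

Lemma even_coefs2 f : even_coefs (2%:R * f).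
Proof.
apply: even_coefsMl => n; rewrite mulr2n fcoefD; move: (fcoef _ _) => x.
by apply/dvdzP; exists x; lia.
Qed.

Lemma even_qpochB (a Q : {fps int}) n : even_coefs (qpoch a Q n - qpoch (- a) Q n).
Proof.
elim: n => [|n IHn]; first by move=> n; rewrite !qpoch0 subrr.
rewrite !qpochS.
have -> : qpoch a Q n * (1 - a * Q ^+ n) - qpoch (- a) Q n * (1 - - a * Q ^+ n) =
    (qpoch a Q n - qpoch (- a) Q n) * (1 - a * Q ^+ n)
    + 2%:R * (- (a * Q ^+ n * qpoch (- a) Q n)) by ring.
by apply: even_coefsD; [apply: even_coefsMl | apply: even_coefs2].
Qed.

Lemma even_qpoch_infB (a Q : {fps int}) : fcoef a 0 = 0 -> fcoef Q 0 = 0 ->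
  even_coefs (qpoch_inf a Q - qpoch_inf (- a) Q).
Proof.
move=> a0 Q0 n; have := @even_qpochB a Q n.+1 n; rewrite !fcoefB.
rewrite (qpoch_inf_eqm a0 Q0 (leqnn n.+1)) //.
by rewrite (qpoch_inf_eqm (coef0N a0) Q0 (leqnn n.+1)).
Qed.

Lemma even_J_sqr m : (0 < m)%N -> even_coefs (J m ^+ 2 - J (2 * m)).
Proof.
move=> m0; have q0 := coefq0 m0; have := even_qpoch_infB q0 q0.
have -> : J (2 * m) = J m * qpoch_inf (- 'q ^+ m) ('q ^+ m).
  by rewrite /J (qpoch_infNM q0 q0) -exprM mulnC.
rewrite -/(J m); move: (J m) (qpoch_inf _ _) => a b e.
have -> : a ^+ 2 - a * b = a * (a - b) by ring.
exact: even_coefsMr.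
Qed.

(** As J_m^2 and J_(2m) agree modulo 2, J_2^3 J_3^2 agrees with
    J_1^6 J_6 = J_1^3 (J_1^3 J_6). *)
Lemma even_quotient_cube : even_coefs (even_quotient - J 1 ^+ 3).
Proof.
have alg (a1 a2 a3 a6 : {fps int}) : a1 \is a GRing.unit -> a6 \is a GRing.unit ->
    even_coefs (a1 ^+ 2 - a2) -> even_coefs (a3 ^+ 2 - a6) ->
    even_coefs (a2 ^+ 3 * a3 ^+ 2 / (a1 ^+ 3 * a6) - a1 ^+ 3).
  move=> u1 u6 e2 e6; have u : a1 ^+ 3 * a6 \is a GRing.unit.
    by rewrite unitrM unitrX // u6.
  have -> : a2 ^+ 3 * a3 ^+ 2 / (a1 ^+ 3 * a6) - a1 ^+ 3 =
      (a2 ^+ 3 * a3 ^+ 2 - a1 ^+ 3 * (a1 ^+ 3 * a6)) / (a1 ^+ 3 * a6).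
    by rewrite mulrBl mulrK.
  apply: even_coefsMl.
  have -> : a2 ^+ 3 * a3 ^+ 2 - a1 ^+ 3 * (a1 ^+ 3 * a6) =
      a2 ^+ 3 * (a3 ^+ 2 - a6)
      + - (a6 * (a1 ^+ 4 + a1 ^+ 2 * a2 + a2 ^+ 2)) * (a1 ^+ 2 - a2) by ring.
  by apply: even_coefsD; apply: even_coefsMr.
exact: (alg _ _ _ _ (J_unitS 0) (J_unitS 5) (@even_J_sqr 1 isT) (@even_J_sqr 3 isT)).
Qed.

(** Jacobi's series: the coefficient at k(k+1)/2 is the odd number
    (-1)^k (2k+1), and distinct k >= 0 give distinct exponents. *)
Lemma odd_coef_J_cube n :
  ~~ (2 %| fcoef (J 1 ^+ 3) n)%Z <-> exists k : int, n%:Z = (k * (k + 1) %/ 2)%Z.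
Proof.
have triK k : (k * (k + 1) %/ 2)%Z = (tri k)%:Z by rewrite -triE mulKz.
pose e (k : nat) := 'C(k.+1, 2); pose a (k : nat) : int := (-1) ^+ k * (2 * k + 1)%N%:Z.
have eS k : e k.+1 = (e k + k.+1)%N by rewrite /e binS bin1.
have eI : injective e.
  have mono : {mono e : x y / (x < y)%N}.
    apply: leqW_mono; apply: leq_mono => x y; elim: y => // y IHy.
    by rewrite eS ltnS leq_eqVlt => /predU1P[->|/IHy]; lia.
  by move=> x y exy; case: (ltngtP x y) => //; rewrite -mono exy ltnn.
have en k : (k <= e k)%N by rewrite /e binS bin1 leq_addl.
have -> : J 1 ^+ 3 = wseries a e.
  have q0 := coefq0 (isT : 0 < 1)%N.
  rewrite /J -(jacobi_cube q0) -wseries_nat //; apply: eq_fps_sum => k.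
  rewrite /a intrM intr_sign expr1; move: ('q ^+ _) => z.
  by rewrite -pmulrn; ring.
split=> [|[k]].
  case: (pselect (exists k, e k = n)) => [[k <-] _|ne].
    by exists (Posz k); rewrite triK.
  rewrite /= fsbig1 ?dvdz0 // => k /= ek; by case: ne; exists k.
rewrite triK => -[nE].
have [j ej] : exists j, n = e j by case: k nE => j nE; exists j.
rewrite /= (_ : [set k | e k = n]%classic = [set j]%classic); last first.
  by rewrite ej; apply/seteqP; split=> x /= => [/eI|->].
rewrite fsbig_set1 /a; rewrite dvdzE /= abszM abszX /= exp1n mul1n.
by lia.
Qed.

(** Modulo 2 the quotient (q^(2m+1);q^2)_oo/(-q^(2m+1);q^2)_oo is 1, and what
    remains of the term is the series q^(2m) (q^(4m+4);q^4)_oo in q^2. *)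
Lemma even_bterm_odd_coef m n : (2 %| fcoef (bterm 'q (2 * m)) (2 * n).+1)%Z.
Proof.
have key (q : {fps int}) : fcoef q 0 = 0 ->
    even_coefs (bterm q (2 * m) - q ^+ (2 * m) * qpoch_inf ((q ^+ (2 * m).+2) ^+ 2) ((q ^+ 2) ^+ 2)).
  move=> q0; have qS k : fcoef (q ^+ k.+1) 0 = 0 by apply: coef0X.
  rewrite -(qpoch_infNM (qS _) (qS 1%N)) /bterm.
  rewrite (qpoch_inf_dissect2 (qS (2 * m)%N) q0) -(exprSr q (2 * m).+1).
  have := even_qpoch_infB (qS (2 * m)%N) (qS 1%N).
  have : qpoch_inf (- q ^+ (2 * m).+1) (q ^+ 2) \is a GRing.unit.
    by apply: qpoch_inf_unit => //; apply: coef0N.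
  move: (qpoch_inf (q ^+ (2 * m).+1) _) (qpoch_inf (- q ^+ (2 * m).+1) _).
  move: (qpoch_inf (q ^+ (2 * m).+2) _) (qpoch_inf (- q ^+ (2 * m).+2) _).
  move: (q ^+ (2 * m)) => x a b c d ud e.
  have -> : x * (c * a) * b / d - x * (a * b) = x * a * b / d * (c - d).
    transitivity (x * (c * a) * b / d - x * (a * b) * (d / d)); last by ring.
    by rewrite mulrV // mulr1.
  exact: even_coefsMr.
have q0 : fcoef 'q 0 = 0 by [].
have q20 : fcoef ('q ^+ 2) 0 = 0 by apply: coef0X.
have qm0 : fcoef ('q ^+ (2 * m).+2) 0 = 0 by apply: coef0X.
have sqM (f g f' g' : {fps int}) : fps_sq f = f' -> fps_sq g = g' ->
    fps_sq (f * g) = f' * g' by move=> <- <-; apply: rmorphM.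
have sqX k : fps_sq ('q ^+ k) = ('q ^+ k) ^+ 2.
  have gen (x : {fps int}) : fps_sq x = x ^+ 2 -> fps_sq (x ^+ k) = (x ^+ k) ^+ 2.
    by move=> e; rewrite rmorphXn /= e -!exprM mulnC.
  by apply: gen; apply: fps_sqX.
have e : fps_sq ('q ^+ m * qpoch_inf ('q ^+ (2 * m).+2) ('q ^+ 2)) =
    'q ^+ (2 * m) * qpoch_inf (('q ^+ (2 * m).+2) ^+ 2) (('q ^+ 2) ^+ 2).
  apply: sqM; first by rewrite sqX -exprM mulnC.
  by rewrite (fps_sq_qpoch_inf qm0 q20) sqX sqX.
have := key 'q q0 (2 * n).+1; rewrite -e fcoefB.
have -> : fcoef (fps_sq ('q ^+ m * qpoch_inf ('q ^+ (2 * m).+2) ('q ^+ 2))) (2 * n).+1 = 0.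
  by rewrite /fps_sq /=; case: ifP => //; lia.
by rewrite subr0.
Qed.

(** * Coefficients of lambda by the parity of the exponent *)

Lemma fcoef_qM (f : {fps int}) n : fcoef ('q * f) n.+1 = fcoef f n.
Proof. by rewrite -['q]expr1 fcoefXnM subn1. Qed.

Lemma fcoef_qM0 (f : {fps int}) : fcoef ('q * f) 0 = 0.
Proof. by rewrite fcoefM0 mul0r. Qed.

Lemma fcoef_fps_sq_even (f : {fps int}) n : fcoef (fps_sq f) (2 * n) = fcoef f n.
Proof. by rewrite /= dvdn_mulr // mulKn. Qed.

Lemma fcoef_fps_sq_odd (f : {fps int}) n : fcoef (fps_sq f) (2 * n).+1 = 0.
Proof. by rewrite /=; case: ifP => //; lia. Qed.

Lemma fcoef_intM (m : nat) (f : {fps int}) n :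
  fcoef (m%:R * f) n = m%:Z * fcoef f n.
Proof.
elim: m => [|m IHm]; first by rewrite !mul0r.
by rewrite mulrS mulrDl mul1r fcoefD IHm; move: (fcoef f n) => x; lia.
Qed.

Definition even_part : {fps int} := fps_sum 0 (fun m => bterm 'q (2 * m)).
Definition odd_part : {fps int} := fps_sum 0 (fun m => bterm 'q (2 * m + 1)).

Lemma lambda6_parts : lambda6 = even_part + odd_part.
Proof.
have q0 : fcoef 'q 0 = 0 by [].
by rewrite /lambda6 (lambda6_bterm q0) (fps_sum_parity (summable_bterm q0)).
Qed.

Lemma odd_part_psi6 : 'q * odd_part = fps_sq psi6.
Proof. exact: bterm_odd. Qed.

Lemma parts_quotients :
  even_part - odd_part = fps_sq even_quotient - 3%:R * 'q * fps_sq odd_quotient.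
Proof.
have q0 : fcoef 'q 0 = 0 by [].
rewrite -alternating_dissection; have sb := summable_bterm q0.
have sa : summable (fun k => (-1) ^+ k * bterm 'q k).
  by move=> k; apply: eqm0Mr; apply: sb.
have so : summable (fun m => bterm 'q (2 * m + 1)).
  by move=> n; apply: eqm_leq (sb (2 * n + 1)%N); lia.
rewrite (fps_sum_parity sa); congr (_ + _).
  by apply: eq_fps_sum => m; rewrite exprM sqrrN expr1n expr1n mul1r.
transitivity (-1 * odd_part); first by rewrite mulN1r.
rewrite /odd_part -(fps_sumMl (-1) so); apply: eq_fps_sum => m.
by rewrite addn1 exprS exprM sqrrN expr1n expr1n mulr1.
Qed.

Lemma even_part_odd_coef n : (2 %| fcoef even_part (2 * n).+1)%Z.
Proof.
have q0 : fcoef 'q 0 = 0 by []; have sb := summable_bterm q0.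
have se : summable (fun m => bterm 'q (2 * m)).
  by move=> k; apply: eqm_leq (sb (2 * k)%N); lia.
rewrite (fps_sum_eqm se (leqnn (2 * n).+2)) // fcoef_sum.
by apply: rpred_sum => m _; apply: even_bterm_odd_coef.
Qed.

Lemma fcoef_odd_part_even n : fcoef odd_part (2 * n) = 0.
Proof. by rewrite -fcoef_qM odd_part_psi6 fcoef_fps_sq_odd. Qed.

Lemma fcoef_odd_part_odd n : fcoef odd_part (2 * n).+1 = fcoef psi6 n.+1.
Proof. by rewrite -fcoef_qM odd_part_psi6 -[(2 * n).+2](mulnS 2 n) fcoef_fps_sq_even. Qed.

Lemma fcoef_lambda6 n :
  fcoef lambda6 n = fcoef even_part n + fcoef odd_part n.
Proof. by rewrite lambda6_parts. Qed.

Lemma fcoef_even_part n :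
  fcoef even_part n = fcoef odd_part n + fcoef (fps_sq even_quotient) n
    - 3 * fcoef ('q * fps_sq odd_quotient) n.
Proof.
have -> : even_part = odd_part + (fps_sq even_quotient - 3%:R * ('q * fps_sq odd_quotient)).
  by rewrite mulrA -parts_quotients addrC subrK.
by rewrite fcoefD fcoefB fcoef_intM addrA.
Qed.

Lemma lambda6_even n : fcoef lambda6 (2 * n) = fcoef even_quotient n.
Proof.
rewrite fcoef_lambda6 fcoef_even_part fcoef_odd_part_even add0r addr0.
rewrite fcoef_fps_sq_even; case: n => [|n]; first by rewrite muln0 fcoef_qM0 mulr0 subr0.
by rewrite mulnS fcoef_qM fcoef_fps_sq_odd mulr0 subr0.
Qed.

Lemma lambda6_odd n :
  fcoef lambda6 (2 * n).+1 = 2 * fcoef psi6 n.+1 - 3 * fcoef odd_quotient n.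
Proof.
rewrite fcoef_lambda6 fcoef_even_part fcoef_odd_part_odd fcoef_fps_sq_odd.
rewrite fcoef_qM fcoef_fps_sq_even.
by move: (fcoef psi6 _) (fcoef odd_quotient _) => x y; ring.
Qed.

Lemma lambda6_odd_mod2 n :
  (fcoef lambda6 (2 * n).+1 = fcoef psi6 n.+1 %[mod 2])%Z.
Proof.
rewrite fcoef_lambda6 fcoef_odd_part_odd; have /dvdzP[x ->] := even_part_odd_coef n.
by rewrite modzMDl.
Qed.

Theorem theorem6p5 :
  [/\ fps_sum 0 (fun n => (fcoef lambda6 (2 * n))%:~R * 'q ^+ n)
        = J 2 ^+ 3 * J 3 ^+ 2 / (J 1 ^+ 3 * J 6),
      fps_sum 1 (fun n => (2 * fcoef psi6 n - fcoef lambda6 (2 * n - 1))%:~R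
                          * 'q ^+ n)
        = 3%:R * 'q * (J 6 ^+ 3 / (J 1 * J 2)),
      forall n : nat, (1 <= n)%N ->
        (fcoef lambda6 (2 * n - 1) = fcoef psi6 n %[mod 2])%Z
    & forall n : nat,
        ~~ (2 %| fcoef lambda6 (2 * n))%Z <->
        exists k : int, n%:Z = (k * (k + 1) %/ 2)%Z].
Proof.
have pred_odd n : (2 * n.+1 - 1 = (2 * n).+1)%N by lia.
split=> [|||n].
- apply/fpsP => n; rewrite (fcoef_sum_Xn _ 0 (fun n => fcoef lambda6 (2 * n))) intz.
  exact: lambda6_even.
- apply/fpsP => n.
  rewrite (fcoef_sum_Xn _ 1 (fun n => 2 * fcoef psi6 n - fcoef lambda6 (2 * n - 1))).
  rewrite intz -mulrA fcoef_intM; case: n => [|n]; first by rewrite fcoef_qM0 mulr0.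
  by rewrite pred_odd lambda6_odd fcoef_qM opprB addrC subrK.
- by case=> // n _; rewrite pred_odd; apply: lambda6_odd_mod2.
rewrite lambda6_even -odd_coef_J_cube.
have := even_quotient_cube n; rewrite fcoefB => e.
by rewrite -(subrK (fcoef (J 1 ^+ 3) n) (fcoef even_quotient n)) rpredDl.
Qed.
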